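(* Let $(b,B,m,\mu)$ be an admissible parameter set whose linear effective drift operator $\hat B$ satisfies $s(\hat B):=\sup\{\Re(\lambda):\lambda\in\sigma(\hat B)\}<0$, let $(p_t(x,\cdot))_{t\ge0}$, $x\in\mathcal H^+$, be the transition kernels of the associated affine process on $\mathcal H^+$, and let $\pi$ be the unique invariant probability measure of $(p_t(x,\cdot))_{t\ge 0}$. Then there exists a Markov process $(X_t^\pi)_{t\ge0}$ on $\mathcal H^+$ with transition kernels $(p_t(x,\cdot))_{t\ge0}$ such that the distribution of $X_t^\pi$ equals $\pi$ for all $t\ge0$.
   Context: Let $(H,\langle\cdot,\cdot\rangle_H)$ be a separable real Hilbert space, $\mathcal H$ the real Hilbert space of self-adjoint Hilbert-Schmidt operators on $H$ with inner product $\langle A,B\rangle=\mathrm{Tr}(BA)$ and norm $\|\cdot\|$, and $\mathcal H^+\subset\mathcal H$ the closed convex cone of positive operators. $\mathcal L(\mathcal H)$ denotes the bounded linear operators on $\mathcal H$, $B^*$ the adjoint. Put $\chi(\xi)=\xi\,\mathbf 1_{\{\|\xi\|\le 1\}}$. An admissible parameter set $(b,B,m,\mu)$ consists of: (1) a measure $m:\mathcal B(\mathcal H^+\setminus\{0\})\to[0,\infty]$ with $\int\|\xi\|^2m(d\xi)<\infty$, $\int|\langle\chi(\xi),h\rangle|\,m(d\xi)<\infty$ for all $h\in\mathcal H$, and such that there is $I_m\in\mathcal H$ with $\langle I_m,h\rangle=\int\langle\chi(\xi),h\rangle m(d\xi)$ for all $h\in\mathcal H$; (2) a vector $b\in\mathcal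 H$ with $\langle b,v\rangle-\int\langle\chi(\xi),v\rangle m(d\xi)\ge 0$ for all $v\in\mathcal H^+$; (3) an $\mathcal H^+$-valued (countably additive) measure $\mu:\mathcal B(\mathcal H^+\setminus\{0\})\to\mathcal H^+$ such that $\int\langle\chi(\xi),u\rangle\frac{\langle x,\mu(d\xi)\rangle}{\|\xi\|^2}<\infty$ for all $u,x\in\mathcal H^+$ with $\langle u,x\rangle=0$; (4) an operator $B\in\mathcal L(\mathcal H)$ with $\langle B^*(u),x\rangle-\int\langle\chi(\xi),u\rangle\frac{\langle\mu(d\xi),x\rangle}{\|\xi\|^2}\ge 0$ for all $x,u\in\mathcal H^+$ with $\langle u,x\rangle=0$. All integrals are over $\mathcal H^+\setminus\{0\}$. Integrals of scalar functions against $\mu$ are $\mathcal H$-valued. Effective drift operator: $\hat B(u)=B^*(u)+\int_{\{\|\xi\|>1\}}\langle\xi,u\rangle\frac{\mu(d\xi)}{\|\xi\|^2}$, $u\in\mathcal H$; $\hat B\in\mathcal L(\mathcal H)$ and $\sigma(\hat B)$ is its spectrum. For $u\in\mathcal H^+$ put $F(u)=\langle b,u\rangle-\int(e^{-\langle\xi,u\rangle}-1+\langle\chi(\xi),u\rangle)\,m(d\xi)$, $R(u)=B^*(u)-\int(e^{-\langle\xi,u\rangle}-1+\langle\chi(\xi),u\rangle)\frac{\mu(d\xi)}{\|\xi\|^2}$. For every $u\in\mathcal H^+$ the equations $\partial_t\phi(t,u)=F(\psi(t,u))$, $\phi(0,u)=0$, $\partial_t\psi(t,u)=R(\psi(t,u))$,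 $\psi(0,u)=u$ have unique global solutions $\phi(\cdot,u)\in C^1([0,\infty),[0,\infty))$ and $\psi(\cdot,u)\in C^1([0,\infty),\mathcal H^+)$. Known existence result (Cox, Karbach, Khedher): for every admissible parameter set there is a conservative time-homogeneous Markov process on $\mathcal H^+$ (the affine process associated with $(b,B,m,\mu)$) whose transition kernels $p_t(x,\cdot)$ (probability measures on $\mathcal H^+$) are uniquely determined by $\int_{\mathcal H^+}e^{-\langle\xi,u\rangle}p_t(x,d\xi)=e^{-\phi(t,u)-\langle x,\psi(t,u)\rangle}$ for all $t\ge0$, $u,x\in\mathcal H^+$; moreover $\int\|\xi\|^2p_t(x,d\xi)\le Ke^{\omega t}(1+\|x\|^2)$ for some constants $K,\omega\ge1$. A Borel probability measure $\pi$ on $\mathcal H^+$ is invariant if $\int_{\mathcal H^+}p_t(x,A)\,\pi(dx)=\pi(A)$ for all $t\ge0$ and Borel $A$. Under $s(\hat B)<0$ there is exactly one invariant probability measure $\pi$, and it is inner-regular with respect to weakly compact sets. *)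

(* Defs.v *)
From HB Require Import structures.
From mathcomp Require Import all_boot all_order all_algebra.
From mathcomp Require Import all_classical all_reals all_analysis.
From mathcomp Require Import complex ring lra.

Set Implicit Arguments.
Unset Strict Implicit.
Unset Printing Implicit Defensive.
Import Order.TTheory GRing.Theory Num.Theory.
Import numFieldNormedType.Exports.

Local Open Scope classical_set_scope.
Local Open Scope ring_scope.

HB.mixin Record NormedModule_hasInner (R : realType) V
    & NormedModule R V := {
  inner : V -> V -> R;
  innerC : forall x y, inner x y = inner y x;
  innerP : forall a x y z, inner (a *: x + y) z = a * inner x z + inner y z;
  inner_norm : forall x, inner x x = `|x| ^+ 2
}.

#[short(type="innerProductType")]
HB.structure Definition InnerProduct (R : realType) :=
  {V of NormedModule R V & NormedModule_hasInner R V}.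

#[short(type="hilbertType")]
HB.structure Definition Hilbert (R : realType) :=
  {V of CompleteNormedModule R V & NormedModule_hasInner R V}.

Definition separable (T : topologicalType) :=
  exists D : set T, countable D /\ dense D.

Section inner_theory.
Variables (R : realType) (V : innerProductType R).
Implicit Types x y z : V.

Lemma innerDl x y z : inner (x + y) z = inner x z + inner y z.
Proof. by rewrite -[x]scale1r innerP mul1r scale1r. Qed.

Lemma inner0l z : inner (0 : V) z = 0.
Proof. by apply: (addrI (inner (0 : V) z)); rewrite -innerDl !addr0. Qed.

Lemma innerZl a x z : inner (a *: x) z = a * inner x z.
Proof. by rewrite -[a *: x]addr0 innerP inner0l addr0. Qed.

Lemma innerNl x z : inner (- x) z = - inner x z.
Proof. by rewrite -scaleN1r innerZl mulN1r. Qed.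

Lemma innerBl x y z : inner (x - y) z = inner x z - inner y z.
Proof. by rewrite innerDl innerNl. Qed.

Lemma innerDr x y z : inner x (y + z) = inner x y + inner x z.
Proof. by rewrite !(innerC x) innerDl. Qed.

Lemma innerZr a x z : inner x (a *: z) = a * inner x z.
Proof. by rewrite !(innerC x) innerZl. Qed.

Lemma innerBr x y z : inner x (y - z) = inner x y - inner x z.
Proof. by rewrite !(innerC x) innerBl. Qed.

Lemma inner_ge0 x : 0 <= inner x x.
Proof. by rewrite inner_norm exprn_ge0. Qed.

Lemma inner_eq0 x : inner x x = 0 -> x = 0.
Proof.
by rewrite inner_norm => /eqP; rewrite expf_eq0/= normr_eq0 => /eqP.
Qed.

Lemma inner_le x y : `|inner x y| <= inner x x + inner y y.
Proof.
have := inner_ge0 (x - y); have := inner_ge0 (x + y).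
have := inner_ge0 x; have := inner_ge0 y.
rewrite !(innerDl, innerNl, innerBr, innerDr) (innerC y x) ler_norml.
by move=> ? ? ? ?; apply/andP; split; lra.
Qed.

Lemma inner_parallelogram x y :
  inner (x + y) (x + y) <= 2 * inner x x + 2 * inner y y.
Proof.
have := inner_ge0 (x - y); rewrite !(innerDl, innerNl, innerBr, innerDr).
by rewrite (innerC y x) => ?; lra.
Qed.

End inner_theory.

Section sum.
Variables (R : realType) (T : choiceType).
Implicit Types (E : set T) (f g : T -> R).

(* The sum over [E] of a (possibly signed) summable family. *)
Definition rsum E f : R :=
  fine (\esum_(e in E) (EFin \o f)^\+ e - \esum_(e in E) (EFin \o f)^\- e).

Local Notation summ E f := (summable E (EFin \o f)).

Lemma le_summable E f g : (forall e, E e -> `|f e| <= g e) ->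
  summ E g -> summ E f.
Proof.
move=> fg; rewrite /summable; apply: le_lt_trans; apply: le_esum => e Ee /=.
by rewrite lee_fin (le_trans (fg _ Ee)) // ler_norm.
Qed.

Lemma summD E f g : summ E f -> summ E g -> summ E (fun e => f e + g e).
Proof. by move=> sf sg; exact: summableD sf sg. Qed.

Lemma esumZ E f a : 0 <= a -> (forall e, 0 <= f e) ->
  (\esum_(e in E) (a * f e)%:E = a%:E * \esum_(e in E) (f e)%:E)%E.
Proof.
move=> a0 f0; rewrite /esum -ereal_supZl//; last first.
  by apply/set0P; exists 0%E => /=; exists set0; [exact: fsets_set0|exact: fsbig_set0].
congr ereal_sup; apply/seteqP; split => [_ [A AE <-]|_ [_ [A AE <-] <-]] /=.
  exists (\sum_(x \in A) (f x)%:E)%E; first by exists A.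
  by rewrite ge0_mule_fsumr.
by exists A => //; rewrite ge0_mule_fsumr.
Qed.

Lemma summZ E f a : summ E f -> summ E (fun e => a * f e).
Proof.
rewrite /summable => sf.
rewrite (_ : esum _ _ = \esum_(e in E) (`|a| * `|f e|)%:E)%E; last first.
  by apply: eq_esum => e _ /=; rewrite normrM.
rewrite esumZ// -ge0_fin_numE ?mule_ge0 ?esum_ge0//.
by rewrite fin_numM// ge0_fin_numE// esum_ge0.
Qed.

Lemma esum_fin E f : (forall e, 0 <= f e) -> summ E f ->
  (\esum_(e in E) (f e)%:E)%E \is a fin_num.
Proof.
move=> f0; rewrite summableE; congr (_ \is a fin_num).
by apply: eq_esum => e _ /=; rewrite ger0_norm.
Qed.

Lemma rsumB E f g : (forall e, 0 <= f e) -> (forall e, 0 <= g e) ->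
  summ E f -> summ E g -> rsum E (fun e => f e - g e) =
  fine (\esum_(e in E) (f e)%:E)%E - fine (\esum_(e in E) (g e)%:E)%E.
Proof.
move=> f0 g0 sf sg; rewrite -fineB ?esum_fin// /rsum; congr fine.
have := @esumB R T E (EFin \o f) (EFin \o g) sf sg.
by apply => e _ /=; rewrite lee_fin.
Qed.

Lemma rsum_ge0E E f : (forall e, 0 <= f e) -> summ E f ->
  rsum E f = fine (\esum_(e in E) (f e)%:E)%E.
Proof.
move=> f0 sf; have s0 : summ E (fun=> 0 : R).
  by apply: (@le_summable E (fun=> 0) f) => // e _; rewrite normr0.
rewrite (_ : f = (fun e => f e - 0)) ?rsumB//; last first.
  by apply/funext => e; rewrite subr0.
rewrite [X in _ - fine X]esum1//= subr0.
by congr fine; apply: eq_esum => e _; rewrite subr0.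
Qed.

Lemma rsumBE E f : summ E f -> exists g h : T -> R, [/\ forall e, 0 <= g e,
   forall e, 0 <= h e, summ E g, summ E h & f = (fun e => g e - h e)].
Proof.
move=> sf; have s1 : summ E (fun e => `|f e|).
  by rewrite /summable; under eq_esum do rewrite /= normr_id; exact: sf.
exists (fun e => `|f e| + f e), (fun e => `|f e|); split => // [e||].
- have := ler_norm (- f e); rewrite normrN; lra.
- exact: summD.
- by apply/funext => e; rewrite addrC addKr.
Qed.

Lemma rsumD E f g : summ E f -> summ E g ->
  rsum E (fun e => f e + g e) = rsum E f + rsum E g.
Proof.
move=> /rsumBE[a [b [a0 b0 sa sb ->]]] /rsumBE[c [d [c0 d0 sc sd ->]]].
rewrite (_ : (fun e => _) = (fun e => (a e + c e) - (b e + d e))); last first.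
  by apply/funext => e; rewrite opprD addrACA.
have D (u v : T -> R) : (forall e, 0 <= u e) -> (forall e, 0 <= v e) -> summ E u ->
    summ E v -> fine (\esum_(e in E) (u e + v e)%:E) =
    fine (\esum_(e in E) (u e)%:E) + fine (\esum_(e in E) (v e)%:E).
  move=> u0 v0 su sv; rewrite -fineD ?esum_fin//; congr fine.
  by rewrite (@esumD R T E (EFin \o u) (EFin \o v))// => e _ /=; rewrite lee_fin.
rewrite !rsumB ?D //; [ring| | | |]; first [exact: summD|by move=> e; rewrite addr_ge0].
Qed.

Lemma rsumN E f : summ E f -> rsum E (fun e => - f e) = - rsum E f.
Proof.
move=> /rsumBE[a [b [a0 b0 sa sb ->]]].
rewrite (_ : (fun e => _) = (fun e => b e - a e)); last first.
  by apply/funext => e; rewrite opprB.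
by rewrite !rsumB// opprB.
Qed.

Lemma rsumZ E f c : summ E f -> rsum E (fun e => c * f e) = c * rsum E f.
Proof.
have P d : 0 <= d -> summ E f -> rsum E (fun e => d * f e) = d * rsum E f.
  move=> d0 /rsumBE[a [b [a0 b0 sa sb ->]]].
  rewrite (_ : (fun e => _) = (fun e => d * a e - d * b e)); last first.
    by apply/funext => e; rewrite mulrBr.
  rewrite !rsumB//; [|by move=> e; rewrite mulr_ge0..|exact: summZ|exact: summZ].
  by rewrite !esumZ// !fineM ?esum_fin// mulrBr.
have [c0|c0] := leP 0 c; first exact: P.
move=> sf; rewrite (_ : (fun e => _) = (fun e => - ((- c) * f e))); last first.
  by apply/funext => e; rewrite mulNr opprK.
by rewrite rsumN ?P ?oppr_ge0 1?ltW// ?mulNr ?opprK//; exact: summZ.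
Qed.

End sum.

Section orthonormal_basis.
Variables (R : realType) (H : innerProductType R).

Definition orthonormal_basis (E : set H) :=
  [/\ forall e, E e -> inner e e = 1,
      forall e f, E e -> E f -> e <> f -> inner e f = 0 &
      forall x, (forall e, E e -> inner x e = 0) -> x = 0].

Lemma orthonormal_basis_ex : exists E, orthonormal_basis E.
Proof.
pose P (E : set H) := (forall e, E e -> inner e e = 1) /\
  (forall e f, E e -> E f -> e <> f -> inner e f = 0).
have [F FP Ftot|E [[E1 E2] Emax]] := @Zorn_bigcup H P.
  split => [e [X FX Xe]|e f [X FX Xe] [Y FY Yf]].
    by have [+ _] := FP _ FX; apply.
  have [XY|YX] := Ftot _ _ FX FY.
    by have [_ +] := FP _ FY; apply => //; exact: XY.
  by have [_ +] := FP _ FX; apply => //; exact: YX.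
exists E; split => // x xE; apply: contrapT => x0.
have nx0 : `|x| != 0 by rewrite normr_eq0; apply/eqP.
pose y := `|x|^-1 *: x.
have yE e : E e -> inner y e = 0 by move=> Ee; rewrite innerZl xE// mulr0.
have yy : inner y y = 1.
  by rewrite inner_norm normfZV ?expr1n//; exact/eqP.
apply: (Emax (E `|` [set y])).
  split; first exact: subsetUl.
  move=> /(_ y (or_intror erefl)) Ey.
  by have := yE y Ey; rewrite yy => /eqP; rewrite oner_eq0.
split => [e [/E1//|->//]|e f [Ee|->] [Ef|->]//].
- exact: E2.
- by rewrite innerC yE.
- by rewrite yE.
Qed.

(* A fixed orthonormal basis; trace and Hilbert-Schmidt norm do not depend on
   its choice when [H] is complete. *)
Definition onb : set H := xget set0 orthonormal_basis.

Lemma onbP : orthonormal_basis onb.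
Proof. exact: xgetPex orthonormal_basis_ex. Qed.

Definition trace (T : H -> H) : R := rsum onb (fun e => inner (T e) e).

Definition hilbert_schmidt (A : H -> H) :=
  summable onb (fun e => (`|A e| ^+ 2)%:E).

Definition self_adjoint (A : H -> H) :=
  forall x y, inner (A x) y = inner x (A y).

End orthonormal_basis.

Section hs_operators.
Variables (R : realType) (H : innerProductType R).

Definition sa_hs : {pred H -> H} := mem [set A : H -> H |
  [/\ linear A, continuous A, self_adjoint A & hilbert_schmidt A]].

(* Self-adjoint Hilbert-Schmidt operators on [H]. *)
Record hs := HS { hs_fun :> H -> H ; _ : hs_fun \in sa_hs }.

HB.instance Definition _ := [isSub for hs_fun].
HB.instance Definition _ := [Choice of hs by <:].

Local Notation E := (@onb R H).
Local Notation summ f := (summable E (EFin \o f)).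

Lemma hs_summ (A B : H -> H) : hilbert_schmidt A -> hilbert_schmidt B ->
  summ (fun e => inner (A e) (B e)).
Proof.
move=> hA hB; apply: (@le_summable R H E _
   (fun e => `|A e| ^+ 2 + `|B e| ^+ 2)); last exact: summD.
by move=> e _; rewrite -!inner_norm inner_le.
Qed.

Lemma sa_hs_submod : submod_closed sa_hs.
Proof.
split.
  apply/mem_set; split.
  - by move=> a x y; rewrite /= scaler0 addr0.
  - exact: cst_continuous.
  - by move=> x y; rewrite (innerC x); exact: etrans (inner0l y) (esym (inner0l x)).
  - rewrite /hilbert_schmidt/summable esum1// => e _.
    by rewrite /= (_ : (0 : H -> H) e = 0)// normr0 expr0n/= normr0.
move=> a A B /set_mem[lA cA sA hA] /set_mem[lB cB sB hB].
apply/mem_set; split.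
- move=> c x y; rewrite !fctE lA lB /= !scalerDr !scalerA mulrC.
  by rewrite addrACA.
- by move=> x; exact: cvgD (cvgZl_tmp (cA x)) (cB x).
- by move=> x y; rewrite /= !fctE innerDr innerZr innerP sA sB.
- apply: (@le_summable R H E (fun e => `|(a *: A + B) e| ^+ 2)
    (fun e => (2 * a ^+ 2) * `|A e| ^+ 2 + 2 * `|B e| ^+ 2)); last first.
    by apply: summD; exact: summZ.
  move=> e _; rewrite ger0_norm ?exprn_ge0//.
  rewrite -!inner_norm; apply: le_trans (inner_parallelogram _ _) _.
  by rewrite innerZl innerZr; lra.
Qed.

HB.instance Definition _ := GRing.isSubmodClosed.Build R (H -> H) sa_hs
  sa_hs_submod.
HB.instance Definition _ := [SubChoice_isSubLmodule of hs by <:].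

Lemma hsP (A : hs) :
  [/\ linear A, continuous A, self_adjoint A & hilbert_schmidt A].
Proof. by case: A => A /= /set_mem. Qed.

(* Tr(BA) *)
Definition hs_inner (A B : hs) : R := trace (B \o A).

Lemma hs_innerE (A B : hs) :
  hs_inner A B = rsum E (fun e => inner (A e) (B e)).
Proof.
congr rsum; apply/funext => e.
by have [_ _ sB _] := hsP B; rewrite /= sB.
Qed.

Lemma hs_innerC A B : hs_inner A B = hs_inner B A.
Proof.
by rewrite !hs_innerE; congr rsum; apply/funext => e; rewrite innerC.
Qed.

Lemma hs_innerP a (A B C : hs) :
  hs_inner (a *: A + B) C = a * hs_inner A C + hs_inner B C.
Proof.
have [_ _ _ hA] := hsP A; have [_ _ _ hB] := hsP B; have [_ _ _ hC] := hsP C.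
rewrite !hs_innerE -rsumZ; last exact: hs_summ.
rewrite -rsumD; [|by apply: summZ; exact: hs_summ|exact: hs_summ].
by congr rsum; apply/funext => e; rewrite innerP.
Qed.

Lemma hs_inner_ge0 A : 0 <= hs_inner A A.
Proof.
have [_ _ _ hA] := hsP A.
rewrite hs_innerE rsum_ge0E; [|by move=> e; exact: inner_ge0|exact: hs_summ].
by rewrite fine_ge0// esum_ge0// => e _; rewrite lee_fin inner_ge0.
Qed.

Lemma hs_inner_eq0 A : hs_inner A A = 0 -> A = 0.
Proof.
have [lA _ sA hA] := hsP A.
have s0 := hs_summ hA hA.
have p0 e : 0 <= inner (A e) (A e) by exact: inner_ge0.
rewrite hs_innerE rsum_ge0E// => A0.
have Ae e : E e -> A e = 0.
  move=> Ee; apply: inner_eq0; apply/eqP; rewrite eq_le p0 andbT -A0.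
  rewrite -lee_fin fineK ?esum_fin//; apply: esum_ge.
  exists [set e]; first by split; [exact: finite_set1|move=> _ ->].
  by rewrite fsbig_set1.
have [_ _ tot] := @onbP R H.
apply/val_inj/funext => x /=; apply: tot => e Ee.
by rewrite sA Ae// innerC inner0l.
Qed.

Definition hs_norm (A : hs) : R := Num.sqrt (hs_inner A A).

Let hs_inner0 B : hs_inner 0 B = 0.
Proof.
by have := hs_innerP 1 0 0 B; rewrite scale1r addr0 mul1r; lra.
Qed.

Let hs_innerZ a A B : hs_inner (a *: A) B = a * hs_inner A B.
Proof. by rewrite -[a *: A]addr0 hs_innerP hs_inner0 addr0. Qed.

Let hs_innerD A B C : hs_inner (A + B) C = hs_inner A C + hs_inner B C.
Proof. by have := hs_innerP 1 A B C; rewrite scale1r mul1r. Qed.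

Lemma hs_normD A B : hs_norm (A + B) <= hs_norm A + hs_norm B.
Proof.
rewrite -(@ler_pXn2r _ 2)// ?nnegrE ?addr_ge0 ?sqrtr_ge0//.
rewrite sqr_sqrtr ?hs_inner_ge0// sqrrD !sqr_sqrtr ?hs_inner_ge0//.
rewrite !(hs_innerD, hs_innerC _ (A + B)) (hs_innerC B A).
suff : hs_inner A B <= hs_norm A * hs_norm B by move=> ?; lra.
apply: le_trans (ler_norm _) _.
rewrite -sqrtrM ?hs_inner_ge0// -sqrtr_sqr ler_wsqrtr//.
have [BB|BB] := eqVneq (hs_inner B B) 0.
  by rewrite (hs_inner_eq0 BB) hs_innerC hs_inner0 expr0n/= mulr_ge0 ?hs_inner_ge0.
have BB0 : 0 < hs_inner B B by rewrite lt_def BB hs_inner_ge0.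
pose a := - (hs_inner A B / hs_inner B B).
have := hs_inner_ge0 (a *: B + A).
rewrite !(hs_innerP, hs_innerC _ (a *: B + A)) (hs_innerC B A).
rewrite (_ : _ + _ = hs_inner A A - hs_inner A B ^+ 2 / hs_inner B B); last first.
  by rewrite /a; field.
by rewrite subr_ge0 ler_pdivrMr.
Qed.

Lemma hs_normZ a A : hs_norm (a *: A) = `|a| * hs_norm A.
Proof.
rewrite /hs_norm hs_innerZ hs_innerC hs_innerZ mulrA -expr2.
by rewrite sqrtrM ?sqr_ge0// sqrtr_sqr.
Qed.

Lemma hs_norm_eq0 A : hs_norm A = 0 -> A = 0.
Proof.
move=> /eqP; rewrite sqrtr_eq0 => A0; apply: hs_inner_eq0.
by apply/eqP; rewrite eq_le A0 hs_inner_ge0.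
Qed.

HB.instance Definition _ :=
  Lmodule_isNormed.Build R hs hs_normD hs_normZ hs_norm_eq0.

Let hs_inner_norm A : hs_inner A A = `|A| ^+ 2.
Proof. by rewrite -[RHS]/(hs_norm A ^+ 2) sqr_sqrtr// hs_inner_ge0. Qed.

HB.instance Definition _ :=
  NormedModule_hasInner.Build R hs hs_innerC hs_innerP hs_inner_norm.

End hs_operators.

Section positive_cone.
Variables (R : realType) (H : innerProductType R).

Definition positive_hs : set (hs H) := [set A | forall x, 0 <= inner (A x) x].

Lemma positive_hs0 : positive_hs 0.
Proof. by move=> x; rewrite -[leRHS]/(inner (0 : H) x) inner0l. Qed.

Definition hs_cone_top := set_type positive_hs.
HB.instance Definition _ := Topological.on hs_cone_top.
HB.instance Definition _ := isPointed.Build hs_cone_top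
  (exist _ 0 (mem_set positive_hs0)).

(* The cone with the Borel sets of its subspace topology. *)
Definition hs_cone := g_sigma_algebraType (@open hs_cone_top).
HB.instance Definition _ := Measurable.on hs_cone.

Definition op (xi : hs_cone) : hs H := set_val (xi : hs_cone_top).

End positive_cone.

Section riesz_representation.
Variables (R : realType) (V : innerProductType R).

(* The vector representing the functional [l]: it is unique when it exists, and
   exists when [l] is linear and bounded and [V] is complete; 0 otherwise. *)
Definition riesz (l : V -> R) : V := xget 0 [set v | forall h, inner v h = l h].

Definition adjoint (B : V -> V) (u : V) : V := riesz (fun x => inner u (B x)).

End riesz_representation.

Section spectrum.
Variables (R : realType) (V : normedModType R) (T : V -> V).

(* [V * V] stands for the complexification [V + iV]; [complex_shift l] is
   [l - T_C], where [T_C (x + iy) = T x + i T y]. *)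
Definition complex_shift (l : R[i]) (z : V * V) : V * V :=
  (complex.Re l *: z.1 - complex.Im l *: z.2 - T z.1,
   complex.Im l *: z.1 + complex.Re l *: z.2 - T z.2).

Definition spectrum : set R[i] := [set l | ~ exists S : V * V -> V * V,
  [/\ continuous S, cancel (complex_shift l) S & cancel S (complex_shift l)]].

(* Valued in [\bar R]: the spectrum is empty when [V] is the zero space. *)
Definition spectral_bound : \bar R :=
  ereal_sup [set (complex.Re l)%:E | l in spectrum].

End spectrum.

Section parameters.
Variables (R : realType) (H : innerProductType R).
Local Notation Hs := (hs H).
Local Notation Hpos := (hs_cone H).
Implicit Types (m : {measure set Hpos -> \bar R}) (mu : set Hpos -> Hpos).
Implicit Types (B : Hs -> Hs).

(* Measures on the cone minus 0 are represented by measures on the cone that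
   vanish at 0 (see [m_at0] and [mu_at0]), because a [measurableType] is
   pointed and the cone minus 0 is empty when [H] is the zero space. *)
Definition nonzero : set Hpos := [set xi | (op xi) != 0].

Definition chi (xi : Hpos) : Hs := if `|op xi| <= 1 then op xi else 0.

(* Countable additivity is in norm. *)
Definition cone_measure mu :=
  op (mu set0) = 0 /\
  forall F : (set Hpos)^nat, (forall n, measurable (F n)) -> trivIset setT F ->
    (\sum_(0 <= k < n) op (mu (F k))) @[n --> \oo] -->
      op (mu (\bigcup_k F k)).

(* The scalar measure <mu(.), x>; it is nonnegative for [x] in the cone. *)
Definition pairing mu (x : Hs) (A : set Hpos) : \bar R :=
  (inner (op (mu A)) x)%:E.

(* The weak integral of [f] against [mu], a vector of [Hs]. Testing against the
   cone is enough to determine it, since every self-adjoint Hilbert-Schmidt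
   operator is a difference of two positive ones; this avoids integrating
   against the signed measures [pairing mu x] with [x] outside the cone. *)
Definition vint mu (D : set Hpos) (f : Hpos -> R) : Hs :=
  xget 0 [set v : Hs | forall x : Hpos,
    (inner v (op x))%:E = \int[pairing mu (op x)]_(xi in D) (f xi)%:E]%E.

Record admissible (b : Hs) B m mu : Prop := {
  m_at0 : m (~` nonzero) = 0%E ;
  m_sqr : (\int[m]_(xi in nonzero) (`|op xi| ^+ 2)%:E < +oo)%E ;
  m_chi : forall h : Hs,
    (\int[m]_(xi in nonzero) `|inner (chi xi) h|%:E < +oo)%E ;
  m_bary : exists I : Hs, forall h : Hs,
    inner I h = \int[m]_(xi in nonzero) inner (chi xi) h ;
  b_drift : forall v : Hpos,
    0 <= inner b (op v) - \int[m]_(xi in nonzero) inner (chi xi) (op v) ;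
  mu_measure : cone_measure mu ;
  mu_at0 : op (mu (~` nonzero)) = 0 ;
  mu_chi : forall u x : Hpos, inner (op u) (op x) = 0 ->
    (\int[pairing mu (op x)]_(xi in nonzero)
       (inner (chi xi) (op u) / `|op xi| ^+ 2)%:E < +oo)%E ;
  B_linear : linear B ;
  B_bounded : continuous B ;
  B_drift : forall x u : Hpos, inner (op u) (op x) = 0 ->
    0 <= inner (adjoint B (op u)) (op x) -
      fine (\int[pairing mu (op x)]_(xi in nonzero)
        (inner (chi xi) (op u) / `|op xi| ^+ 2)%:E)%E
}.

Definition effective_drift B mu (u : Hs) : Hs :=
  adjoint B u +
  vint mu [set xi | 1 < `|op xi|] (fun xi => inner (op xi) u / `|op xi| ^+ 2).

Definition levy_exponent (u : Hs) (xi : Hpos) : R :=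
  expR (- inner (op xi) u) - 1 + inner (chi xi) u.

Definition Ffun (b : Hs) m (u : Hpos) : R :=
  inner b (op u) - \int[m]_(xi in nonzero) levy_exponent (op u) xi.

Definition Rfun B mu (u : Hpos) : Hs :=
  adjoint B (op u) -
  vint mu nonzero (fun xi => levy_exponent (op u) xi / `|op xi| ^+ 2).

(* [l] is the derivative at [t >= 0] of [f] as a function on [0, +oo), hence a
   right derivative at 0. *)
Definition derive_ge0 (V : normedModType R) (f : R -> V) (t : R) (l : V) :=
  (h^-1 *: (f (t + h) - f t)) @[h --> within [set h | 0 <= t + h] 0^'] --> l.

Record riccati (b : Hs) B m mu (phi : R -> Hpos -> R)
    (psi : R -> Hpos -> Hpos) : Prop := {
  phi0 : forall u, phi 0 u = 0 ;
  psi0 : forall u, psi 0 u = u ;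
  phi_ge0 : forall u t, 0 <= t -> 0 <= phi t u ;
  phi_derive : forall u t, 0 <= t ->
    derive_ge0 (V := R^o) (phi^~ u) t (Ffun b m (psi t u)) ;
  psi_derive : forall u t, 0 <= t ->
    derive_ge0 (fun s => op (psi s u)) t (Rfun B mu (psi t u)) ;
  phi_C1 : forall u, {within [set t | 0 <= t],
    continuous (fun t => Ffun b m (psi t u))} ;
  psi_C1 : forall u, {within [set t | 0 <= t],
    continuous (fun t => Rfun B mu (psi t u))}
}.

End parameters.

(* The time set is [0, +oo): values at negative times are irrelevant. *)
Section markov.
Context d (X : measurableType d) (R : realType) (p : R -> R.-pker X ~> X).

Definition transition_semigroup :=
  (forall x A, measurable A -> p 0 x A = \d_x A) /\
  forall s t x A, 0 <= s -> 0 <= t -> measurable A ->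
    p (s + t) x A = (\int[p s x]_y p t y A)%E.

Definition invariant_measure (pi : probability X R) :=
  forall t A, 0 <= t -> measurable A -> (\int[pi]_x p t x A)%E = pi A.

(* sigma(Y r, 0 <= r <= s) *)
Definition natural_filtration (W : Type) (Y : R -> W -> X) (s : R) :
    set (set W) :=
  <<s [set E | exists r A,
         [/\ 0 <= r, r <= s, measurable A & E = Y r @^-1` A]] >>.

(* The second clause says that [p t (Y s) A], which is
   [natural_filtration Y s]-measurable, is a version of the conditional
   probability of [Y (s + t) \in A] given [natural_filtration Y s]. *)
Definition markov_process d' (W : measurableType d') (P : probability W R)
    (Y : R -> W -> X) :=
  (forall t, 0 <= t -> measurable_fun setT (Y t)) /\
  forall s t E A, 0 <= s -> 0 <= t -> natural_filtration Y s E ->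
    measurable A ->
    P (E `&` Y (s + t) @^-1` A) = (\int[P]_(w in E) p t (Y s w) A)%E.

End markov.

Definition affine_kernels (R : realType) (H : innerProductType R)
    (b : hs H) (B : hs H -> hs H) (m : {measure set (hs_cone H) -> \bar R})
    (mu : set (hs_cone H) -> hs_cone H)
    (p : R -> R.-pker (hs_cone H) ~> (hs_cone H)) :=
  transition_semigroup p /\
  exists phi psi, riccati b B m mu phi psi /\
    forall t (u x : hs_cone H), 0 <= t ->
      \int[p t x]_xi expR (- inner (op xi) (op u)) =
      expR (- phi t u - inner (op x) (op (psi t u))).

(* Main.v *)
(* A stationary process is a Markov process started from its invariant law, so
   the point is Kolmogorov's extension theorem for the time set [0, +oo). The
   cone is a complete separable metric space, hence a measurable retract of a
   space of bit sequences: record the bits |x - c_n| < 2^-k for a dense sequence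
   c, and recover x as a limit. On a product of copies of {0,1} the cylinders
   are clopen subsets of a compact space, so every finitely additive content on
   cylinders is countably additive and extends to a measure. The
   finite-dimensional laws come from redrawing one coordinate after the other
   with the transition kernels; they are consistent by the Chapman-Kolmogorov
   equations. *)
Require Import Defs.
From HB Require Import structures.
From mathcomp Require Import all_boot all_order all_algebra.
From mathcomp Require Import all_classical all_reals all_analysis.
From mathcomp Require Import ring lra measurable_realfun giry.

Set Implicit Arguments.
Unset Strict Implicit.
Unset Printing Implicit Defensive.
Import Order.TTheory GRing.Theory Num.Theory.
Import numFieldNormedType.Exports.

Local Open Scope classical_set_scope.
Local Open Scope ring_scope.

(** * Finite-dimensional laws of a Markov process *)

(** Closed bounded sets of the cone need not be compact, so the classical extension argument would
    have to approximate laws by compact sets. Coding by bits replaces this by a property of clopen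
    sets that holds for every content. There is a price: a bit pattern need not be the code of a
    point, so decoding must be total and measurable on all patterns; and an event at a single time
    may involve infinitely many bits, so laws have to be compared on all measurable sets and not
    only on cylinders of bits. All laws live on the full path space instead of on finite powers of
    the state space. An event at finitely many times is a set of paths that [depends] on a list, and
    consistency is the equality of two measures on one such set. The Markov property is checked for
    events at finitely many times up to [s], where it is the recursive definition of the laws, and
    passes to the natural filtration by Dynkin's theorem. *)

Section product_sigma_algebra.
Context d (J : Type) (S : measurableType d).

Definition cylinders : set (set (J -> S)) :=
  [set (fun w => w j) @^-1` A | j in setT & A in measurable].

Definition product_space := g_sigma_algebraType cylinders.
HB.instance Definition _ := Measurable.on product_space.

Lemma measurable_coord j : measurable_fun [set: product_space] (fun w => w j).
Proof.
move=> _ A mA; rewrite setTI; apply: sub_sigma_algebra.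
by exists j => //; exists A.
Qed.

Lemma measurable_product d' (T : measurableType d') (f : T -> product_space) :
  (forall j, measurable_fun setT (fun x => f x j)) -> measurable_fun setT f.
Proof.
move=> mf; apply: (@measurability _ _ T product_space setT f cylinders) => //.
move=> _ [_ [j _ [A mA <-]] <-].
by have := mf j measurableT _ mA.
Qed.

End product_sigma_algebra.
Arguments product_space {d} J S.

Section kernel_giry.
Context d d' (X : measurableType d) (Y : measurableType d') (R : realType).
Variable k : R.-pker X ~> Y.

Definition kernel_at (x : X) : set Y -> \bar R := k x.
HB.instance Definition _ x := Measure.on (kernel_at x).
HB.instance Definition _ x := Measure_isSubProbability.Build _ _ _
  (kernel_at x) (sprob_kernel_le1 k x).

Definition kgiry (x : X) : giry Y R := kernel_at x.

Lemma measurable_kgiry : measurable_fun setT kgiry.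
Proof.
by apply: measurable_giry_codensity => // A mA; exact: measurable_kernel.
Qed.

End kernel_giry.

Section finite_dimensional_laws.
Context d (X : measurableType d) (R : realType).
Variables (nu : probability X R) (p : R -> R.-pker X ~> X).
Local Notation Omega := (product_space R X).
Implicit Types (w : Omega) (D : seq R) (g : Omega -> \bar R).

Definition upd t (u : Omega * X) : Omega :=
  fun r => if r == t then u.2 else u.1 r.

Lemma measurable_upd t : measurable_fun setT (upd t).
Proof.
apply: measurable_product => r; rewrite /upd; case: (r == t).
  exact: measurable_snd.
exact: measurableT_comp (measurable_coord r) measurable_fst.
Qed.

Lemma measurable_cst_path : measurable_fun setT ((fun x _ => x) : X -> Omega).
Proof. exact: measurable_product. Qed.

(* The law of [w] after its value at [t] is redrawn from [p (t - s) (w s)]. *)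
Definition redraw s t w : giry Omega R :=
  giry_map (measurable_upd t) (giry_prod (giry_ret w, kgiry (p (t - s)%R) (w s))).

Lemma measurable_redraw s t : measurable_fun setT (redraw s t).
Proof.
apply: measurableT_comp; first exact: measurable_giry_map.
apply: measurableT_comp; first exact: measurable_giry_prod.
apply: measurable_fun_pair; first exact: measurable_giry_ret.
apply: measurableT_comp; first exact: measurable_kgiry.
exact: measurable_coord.
Qed.

(* [D] lists the times in decreasing order. *)
Fixpoint law D : giry Omega R :=
  if D is t :: D' then giry_bind (law D') (measurable_redraw (head 0 D') t)
  else giry_map measurable_cst_path (nu : subprobability X R).

Lemma integral_redraw s t w g : measurable_fun setT g -> (forall w, 0 <= g w)%E ->
  (\int[redraw s t w]_w' g w' = \int[p (t - s)%R (w s)]_y g (upd t (w, y)))%E.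
Proof.
move=> mg g0; rewrite -/(giry_int _ _) giry_int_map//.
have mh : measurable_fun setT (g \o upd t).
  exact: measurableT_comp mg (measurable_upd t).
rewrite giry_int_prod2//; last by move=> ?; exact: g0.
apply: eq_integral => y _; rewrite giry_int_ret//.
exact: (measurable_fun_pair1 y mh).
Qed.

Lemma measurable_integral_redraw s t g : measurable_fun setT g ->
  (forall w, 0 <= g w)%E ->
  measurable_fun setT (fun w => \int[p (t - s)%R (w s)]_y g (upd t (w, y)))%E.
Proof.
move=> mg g0; apply: (eq_measurable_fun (fun w => giry_int (redraw s t w) g)).
  by move=> w _; exact: integral_redraw.
exact: measurableT_comp (measurable_giry_int mg g0) (measurable_redraw s t).
Qed.

Lemma integral_law_cons t D g : measurable_fun setT g ->
  (forall w, 0 <= g w)%E ->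
  (\int[law (t :: D)]_w g w = \int[law D]_w
    \int[p (t - head 0 D)%R (w (head 0%R D))]_y g (upd t (w, y)))%E.
Proof.
move=> mg g0; rewrite -/(giry_int _ _) giry_int_bind//.
by apply: eq_integral => w _; exact: integral_redraw.
Qed.

Lemma integral_law_nil g : measurable_fun setT g -> (forall w, 0 <= g w)%E ->
  (\int[law [::]]_w g w = \int[nu]_x g (fun=> x))%E.
Proof. by move=> mg g0; rewrite -/(giry_int _ _) giry_int_map. Qed.

End finite_dimensional_laws.

Section semigroup_integrals.
Context d (X : measurableType d) (R : realType).
Variable p : R -> R.-pker X ~> X.
Hypothesis psg : transition_semigroup p.
Implicit Types h : X -> \bar R.

(** Composition of kernels is a bind in the Giry monad, which carries the Chapman-Kolmogorov
    identity from sets to nonnegative functions. *)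
Lemma integral_semigroupD s t x h : 0 <= s -> 0 <= t ->
  measurable_fun setT h -> (forall y, 0 <= h y)%E ->
  (\int[p (s + t)%R x]_z h z = \int[p s x]_y \int[p t y]_z h z)%E.
Proof.
move=> s0 t0 mh h0.
rewrite -[RHS](@giry_int_bind _ _ _ _ _ (kgiry (p s) x) _ (measurable_kgiry (p t)))//.
apply: eq_measure_integral => A mA _; have [_ ->//] := psg.
by rewrite /giry_bind /= giry_int_map//; exact: measurable_giry_ev.
Qed.

End semigroup_integrals.

Section depends.
Context (J : eqType) (S : Type).

Definition depends (D : seq J) (E : set (J -> S)) :=
  forall w w' : J -> S, {in D, w =1 w'} -> E w -> E w'.

Lemma depends_subset (D D' : seq J) E : {subset D <= D'} -> depends D E ->
  depends D' E.
Proof. by move=> DD' dE w w' ww'; apply: dE => j /DD'; exact: ww'. Qed.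

Lemma dependsE D E w w' : depends D E -> {in D, w =1 w'} ->
  (w \in E) = (w' \in E).
Proof.
move=> dE ww'; apply/idP/idP; rewrite !inE; first exact: dE.
by apply: dE => j /ww'.
Qed.

End depends.

(** * Consistency of the finite-dimensional laws *)

Section consistency.
Context d (X : measurableType d) (R : realType).
Variables (nu : probability X R) (p : R -> R.-pker X ~> X).
Hypothesis psg : transition_semigroup p.
Local Notation Omega := (product_space R X).
Implicit Types (w : Omega) (D : seq R) (g : Omega -> \bar R).
Local Notation law := (law nu p).

Definition times D := path.sorted >%R D && all (>= 0) D.

Let gt_trans : transitive (>%R : rel R).
Proof. by move=> y x z yx zy; exact: lt_trans zy yx. Qed.

Lemma times_cat D1 r D2 : times (D1 ++ r :: D2) -> times (D1 ++ D2).
Proof.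
move=> /andP[sD pD]; apply/andP; split.
  apply: subseq_sorted sD; first exact: gt_trans.
  by apply: cat_subseq => //; exact: subseq_cons.
by move: pD; rewrite !all_cat /= => /and3P[-> _ ->].
Qed.

(* Chapman-Kolmogorov removes the intermediate time [r]. *)
Lemma integral_law_insert D1 r D2 g : times (D1 ++ r :: D2) ->
  measurable_fun setT g -> (forall w, 0 <= g w)%E ->
  (forall w x, g (upd r (w, x)) = g w) ->
  (\int[law (D1 ++ r :: D2)]_w g w = \int[law (D1 ++ D2)]_w g w)%E.
Proof.
elim: D1 g => [|t D1 IH] g.
  move=> _ mg g0 gr; rewrite !cat0s (integral_law_cons nu p r D2 mg g0).
  apply: eq_integral => w _; under eq_integral do rewrite gr.
  by rewrite (integral_cst _ measurableT) prob_kernel mule1.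
case: D1 IH => [_|t' D1 IH] tD mg g0 gr.
- have [rt sD r0 pD] : [/\ r < t, path.path >%R r D2, 0 <= r & all (>= 0) D2].
    by case/andP: tD => /= /andP[? ?] /and3P[].
  (* For empty [D2] the redrawing starts at the default time 0, where the constant path carries the
     initial value. *)
  have hD : 0 <= r - head 0 D2.
    case: D2 sD pD {rt tD} => [|s D2] /=; first by rewrite subr0.
    by move=> /andP[sr _] _; rewrite subr_ge0 ltW.
  have mg' := measurable_integral_redraw p r t mg g0.
  have g'0 w : (0 <= \int[p (t - r)%R (w r)]_y g (upd t (w, y)))%E.
    by apply: integral_ge0.
  rewrite !cat_cons !cat0s (integral_law_cons nu p t (r :: D2) mg g0).
  rewrite (integral_law_cons nu p r D2 mg' g'0).
  rewrite (integral_law_cons nu p t D2 mg g0).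
  apply: eq_integral => w _.
  rewrite (_ : t - head 0 D2 = (r - head 0 D2) + (t - r)); last first.
    by rewrite [RHS]addrC addrA subrK.
  have mgw : measurable_fun setT (fun y => g (upd t (w, y))).
    exact: measurable_fun_pair2 (measurableT_comp mg (measurable_upd t)).
  rewrite [RHS]integral_semigroupD// ?subr_ge0 ?ltW//.
  apply: eq_integral => x _; rewrite {1}/upd /= eqxx.
  (* The updates at [r] and at [t] commute because [r < t], so the value drawn at [r] disappears by
     [gr]. *)
  apply: eq_integral => y _; rewrite -(gr (upd t (w, y)) x); congr g.
  apply/funext => q; rewrite /upd /=; have [->|//] := eqVneq q r.
  by rewrite lt_eqF.
(* The latest time [t] is integrated out. The resulting function still ignores [r]: the kernel
   starts from the value at [t'], which is not [r], and [g] ignores [r]. *)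
- have tD' : times ((t' :: D1) ++ r :: D2).
    by move: tD => /andP[/path_sorted sD /andP[_ pD]]; apply/andP.
  have hE D3 : head 0 ((t' :: D1) ++ D3) = t' by [].
  have r_notin : (t' != r) && (t != r).
    move: tD => /andP[/= /andP[tt']].
    rewrite (path_sortedE gt_trans) all_cat /=.
    move=> /andP[/and3P[_ rt' _] _] _; rewrite (gt_eqF rt') gt_eqF//.
    exact: lt_trans rt' tt'.
  move: r_notin => /andP[t'r tr].
  rewrite cat_cons (integral_law_cons nu p t ((t' :: D1) ++ r :: D2) mg g0).
  rewrite [in RHS]cat_cons (integral_law_cons nu p t ((t' :: D1) ++ D2) mg g0) !hE.
  apply: IH => //.
  + exact: measurable_integral_redraw.
  + by move=> w; exact: integral_ge0.
  + move=> w x; rewrite {1}/upd /= (negPf t'r).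
    apply: eq_integral => y _; rewrite -[RHS](gr _ x); congr g.
    apply/funext => q; rewrite /upd /=; have [->|//] := eqVneq q t.
    by rewrite (negPf tr).
Qed.

(** Times outside [D] are removed one at a time; the strictly decreasing list that remains has the
    members of [D], hence is [D]. *)
Lemma law_subset D D' (E : set Omega) : times D -> times D' -> {subset D <= D'} ->
  measurable E -> depends D E -> law D' E = law D E.
Proof.
move=> tD; have [n] := ubnP (size D'); elim: n D' => // n IH D' Dn tD' DD' mE dE.
have [DE|/allPn[r rD' /= rD]] := boolP (all (mem D) D').
  congr (law _ E); apply: (@irr_sorted_eq _ >%R).
  - exact: gt_trans.
  - by move=> x; rewrite /= ltxx.
  - by case/andP: tD'.
  - by case/andP: tD.
  - by move=> x; apply/idP/idP => [/(allP DE)|/DD'].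
move: rD' => /path.splitPr E'; case: E' => D1 D2 in Dn tD' DD' *.
have I D0 : law D0 E = (\int[law D0]_w (\1_E w)%:E)%E.
  by rewrite integral_indic// setIT.
rewrite [LHS]I integral_law_insert//.
- rewrite -I; apply: IH => //.
  + by move: Dn; rewrite !size_cat /= addnS.
  + exact: times_cat tD'.
  + move=> x xD; have := DD' _ xD; rewrite !mem_cat inE.
    by case: eqVneq => [xr|//]; rewrite -xr xD in rD.
- exact/measurable_EFinP.
- move=> w x; rewrite /= !indicE (dependsE dE (w' := w))// => j jD.
  by rewrite /upd /=; case: eqVneq => // jr; rewrite -jr jD in rD.
Qed.

End consistency.

(** * Kolmogorov's extension theorem *)

Section finitary_sets.
Context (I : eqType).
Implicit Types A B : set (I -> bool).

Definition finitary A := exists D : seq I, depends D A.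

Lemma finitary0 : finitary set0. Proof. by exists [::]. Qed.

Lemma finitaryU : setU_closed finitary.
Proof.
move=> A B [D dA] [D' dB]; exists (D ++ D') => f g fg [Af|Bf].
  by left; apply: dA Af => i iD; apply: fg; rewrite mem_cat iD.
by right; apply: dB Bf => i iD; apply: fg; rewrite mem_cat iD orbT.
Qed.

Lemma dependsC D A : depends D A -> depends D (~` A).
Proof.
by move=> dA f g fg nAf Ag; apply: nAf; apply: (dA g) => // i iD; rewrite fg.
Qed.

Lemma finitaryC : setC_closed finitary.
Proof. by move=> A [D dA]; exists D; exact: dependsC. Qed.

Definition bits := I -> bool.
HB.instance Definition _ := Pointed.on bits.
HB.instance Definition _ := Topological.copy bits {ptws I -> bool}.

Definition bits_display : measure_display. Proof. by constructor. Qed.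

HB.instance Definition _ := @isAlgebraOfSets.Build bits_display bits
  finitary finitary0 finitaryU finitaryC.

Lemma open_finitary A : finitary A -> open (A : set bits).
Proof.
move=> [D dA]; rewrite openE => f Af.
have : nbhs (f : bits) [set g | {in D, f =1 g}].
  elim: D {dA} => [|i D IH]; first by apply: filterS filterT => g _ j.
  have fi : nbhs (f : bits) [set g | g i = f i].
    have := @proj_continuous _ (fun _ : I => bool) i f.
    by move=> /(_ [set f i]) /=; apply; exact: discrete_set1.
  apply: filterS2 fi IH => g gi fg j; rewrite inE => /predU1P[->//|].
  exact: fg.
by apply: filterS => g fg; exact: dA fg Af.
Qed.

(** The sets [F n], each enlarged by the complement of the union, are an open cover of a compact
    space. By disjointness a nonempty [F n] must have its index in the finite subcover. *)
Lemma finitary_bigcup (F : (set (I -> bool))^nat) :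
  (forall n, finitary (F n)) -> trivIset setT F -> finitary (\bigcup_n F n) ->
  exists N, forall n, (N <= n)%N -> F n = set0.
Proof.
move=> fF tF fU.
have : compact [set: bits].
  have := @tychonoff _ (fun _ : I => bool) _ (fun=> bool_compact).
  by congr (compact _); rewrite eqEsubset.
rewrite (@compact_cover bits) => /(_ _ setT (fun n => F n `|` ~` \bigcup_n F n)).
case=> [n _||D _ TD].
- by apply: open_finitary; apply: finitaryU => //; exact: finitaryC.
- move=> f _; have [[n _ Fnf]|nUf] := pselect ((\bigcup_n F n) f).
    by exists n => //; left.
  by exists 0%N => //; right.
exists (\max_(i <- finmap.enum_fset D) i).+1 => n Dn; rewrite -subset0 => f Fnf.
have [m /= mD [Fmf|]] := TD f Logic.I; last by case; exists n.
have mn : m = n by apply: tF => //; exists f.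
have : (n <= \max_(i <- finmap.enum_fset D) i)%N.
  by rewrite -mn; exact: leq_bigmax_seq.
by rewrite leqNgt Dn.
Qed.

End finitary_sets.

Section compact_content.
Context (I : eqType) (R : realType) (mu : {content set (bits I) -> \bar R}).

(* Finitary sets are clopen and the space of bits is compact, so a countable
   partition of a finitary set into finitary sets is finite. *)
Lemma content_bits_sigma_additive : semi_sigma_additive mu.
Proof.
move=> F mF tF mUF.
have [N NF] := finitary_bigcup mF tF mUF.
apply: cvg_near_cst; exists N => // n /= Nn.
rewrite big_mkord -measure_semi_additive_ord_I//; last 2 first.
- exact: sub_trivIset tF.
- exact: bigsetU_measurable.
congr (mu _); rewrite -bigcup_mkord; apply/seteqP; split => f [k /= kn Fkf].
  by exists k.
exists k => //=; rewrite ltnNge; apply/negP => nk.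
by move: Fkf; rewrite NF// (leq_trans Nn).
Qed.

End compact_content.

(** Induction on the list: the set is split by the value of one bit, and with that bit frozen it
    depends on the shorter list. *)
Lemma measurable_preimage_finitary (I : eqType) d (T : measurableType d)
    (e : T -> I -> bool) (A : set (I -> bool)) :
  (forall i, measurable_fun setT (e^~ i)) -> finitary A ->
  measurable (e @^-1` A).
Proof.
move=> me [D]; elim: D A => [|i D IH] A dA.
  have [->|/set0P[f Af]] := eqVneq A set0.
    by rewrite preimage_set0.
  rewrite (_ : A = setT) ?preimage_setT//.
  by apply/seteqP; split => // g _; exact: dA Af.
pose set_at b (f : I -> bool) j := if j == i then b else f j.
have mA b : measurable (e @^-1` (set_at b @^-1` A)).
  apply: IH => f g fg; apply: dA => j; rewrite inE /set_at.
  by case: eqVneq => //= _; exact: fg.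
have mi : measurable [set x | e x i].
  by have := me i measurableT [set true] Logic.I; rewrite setTI.
rewrite (_ : e @^-1` A = ([set x | e x i] `&` (e @^-1` (set_at true @^-1` A)))
    `|` (~` [set x | e x i] `&` (e @^-1` (set_at false @^-1` A)))).
  by apply: measurableU; apply: measurableI => //; exact: measurableC.
have set_atE x : set_at (e x i) (e x) = e x.
  by apply/funext => j; rewrite /set_at; case: eqVneq => // ->.
apply/seteqP; split => x /=; have := set_atE x; case: (e x i) => ->.
- by left.
- by right.
- by case=> -[].
- by case=> -[].
Qed.

(** * Extension for state spaces coded by bits *)

Section kolmogorov_extension.
Context d (X : measurableType d) (R : realType) (J K : choiceType).
Variables (bit : K -> X -> bool) (dec : product_space K bool -> X).
Hypothesis mbit : forall k, measurable_fun setT (bit k).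
Hypothesis mdec : measurable_fun setT dec.
Hypothesis bitK : forall x, dec (bit^~ x) = x.
Local Notation Omega := (product_space J X).
Variable L : seq J -> probability Omega R.
Hypothesis L_consistent : forall (D D' : seq J) (E : set Omega), {subset D <= D'} ->
  measurable E -> depends D E -> L D' E = L D E.
Local Notation I := (J * K)%type.

Let encode (w : Omega) : bits I := fun i => bit i.2 (w i.1).

Let measurable_encode (A : set (bits I)) : finitary A ->
  measurable (encode @^-1` A).
Proof.
apply: measurable_preimage_finitary => i.
exact: measurableT_comp (mbit _) (measurable_coord _).
Qed.

(** The list is an arbitrary one on which [A] depends; by consistency the choice does not matter for
    finitary sets ([premeasureE]). *)
Let premeasure (A : set (bits I)) : \bar R :=
  L [seq i.1 | i <- xget [::] [set D | depends D A]] (encode @^-1` A).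

Let depends_encode D (A : set (bits I)) : depends D A ->
  depends [seq i.1 | i <- D] (encode @^-1` A).
Proof.
move=> dA w w' ww'; apply: dA => i iD; rewrite /encode ww'//.
by apply/mapP; exists i.
Qed.

Let premeasureE D (A : set (bits I)) : depends D A ->
  premeasure A = L [seq i.1 | i <- D] (encode @^-1` A).
Proof.
move=> dA; rewrite /premeasure; set S := xget _ _.
have dSA : depends S A.
  by apply: (@xgetPex _ _ [set D | depends D A]); exists D.
have fA : finitary A by exists D.
pose T := [seq i.1 | i <- S ++ D].
transitivity (L T (encode @^-1` A)); last first.
  apply: L_consistent; [|exact: measurable_encode|exact: depends_encode].
  by move=> j jD; rewrite /T map_cat mem_cat jD orbT.
apply/esym/L_consistent; [|exact: measurable_encode|exact: depends_encode].
by move=> j jS; rewrite /T map_cat mem_cat jS.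
Qed.

Let premeasure_ge0 A : (0 <= premeasure A)%E.
Proof. exact: measure_ge0. Qed.

Let premeasure0 : premeasure set0 = 0%E.
Proof. by rewrite (@premeasureE [::])// preimage_set0 measure0. Qed.

Let premeasure_additive : measure_function.semi_additive premeasure.
Proof.
apply/additive2P => // A B [D dA] [D' dB] AB0.
have dA' : depends (D ++ D') A.
  by apply: depends_subset dA => i iD; rewrite mem_cat iD.
have dB' : depends (D ++ D') B.
  by apply: depends_subset dB => i iD; rewrite mem_cat iD orbT.
have dAB : depends (D ++ D') (A `|` B).
  by move=> f g fg [Af|Bf]; [left; exact: dA' Af|right; exact: dB' Bf].
rewrite !(@premeasureE (D ++ D'))// preimage_setU measureU//.
- by apply: measurable_encode; exists D.
- by apply: measurable_encode; exists D'.
- by rewrite -preimage_setI AB0 preimage_set0.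
Qed.

HB.instance Definition _ := isContent.Build _ _ _ premeasure
  premeasure_ge0 premeasure_additive.
HB.instance Definition _ := Content_isMeasure.Build _ _ _ premeasure
  (@content_bits_sigma_additive _ _ premeasure).

Let bitsM := g_sigma_algebraType (@measurable _ (bits I)).

Let P : {measure set bitsM -> \bar R} := measure_extension premeasure.

Let PE D A : depends D A -> P A = L [seq i.1 | i <- D] (encode @^-1` A).
Proof.
move=> dA; rewrite -(premeasureE dA).
by apply: measurable_mu_extE; exists D.
Qed.

Let decode (f : bitsM) : Omega := fun j => dec (fun k => f (j, k)).

Let measurable_bitsM A : finitary A -> measurable (A : set bitsM).
Proof. by move=> fA; exact: sub_sigma_algebra. Qed.

Let measurable_decode : measurable_fun setT decode.
Proof.
apply: measurable_product => j.
pose slice (f : bitsM) : product_space K bool := fun k => f (j, k).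
suff ms : measurable_fun setT slice by exact: measurableT_comp mdec ms.
apply: measurable_product => k _ B _; rewrite setTI.
apply: measurable_bitsM; exists [:: (j, k)] => f g fg.
by rewrite /preimage/= /slice fg ?inE.
Qed.

Let mask (D : seq J) (f : bitsM) : bitsM := fun i => (i.1 \in D) && f i.

Let measurable_mask D : measurable_fun setT (mask D).
Proof.
apply: (@measurability _ _ bitsM bitsM setT (mask D) (@measurable _ (bits I))) => //.
move=> _ [A [D' dA] <-]; rewrite setTI; apply: measurable_bitsM.
by exists D' => f g fg; apply: dA => i iD'; rewrite /mask fg.
Qed.

Let encodeM (w : Omega) : bitsM := encode w.

Let measurable_encodeM : measurable_fun setT encodeM.
Proof.
apply: (@measurability _ _ Omega bitsM setT encodeM (@measurable _ (bits I))) => //.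
by move=> _ [A fA <-]; rewrite setTI; exact: measurable_encode.
Qed.

(** An event at the times of [D] pulls back under [decode] to a set that need not be finitary, so
    [PE] does not reach it. After masking the other times, both sides are measures in [A] that agree
    on finitary sets, an intersection-stable generator. *)
Let P_mask D (A : set bitsM) : measurable A ->
  P (mask D @^-1` A) = L D ((mask D \o encodeM) @^-1` A).
Proof.
move=> mA.
have me := measurableT_comp (measurable_mask D) measurable_encodeM.
pose m1 : {measure set bitsM -> \bar R} := pushforward P (mask D).
pose m2 : {measure set bitsM -> \bar R} := pushforward (L D) (mask D \o encodeM).
have PT : P setT = 1%E.
  by rewrite (@PE [::])// preimage_setT probability_setT.
apply: (@measure_unique _ R bitsM (@measurable _ (bits I)) (fun=> setT) _ _ _ _
  (m1 (measurable_mask D)) (m2 me)) => //.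
- exact: (@measurableI _ (bits I)).
- by rewrite bigcup_const.
- move=> B [D' dB].
  have dmB : depends [seq i <- D' | i.1 \in D] (mask D @^-1` B).
    move=> f g fg; apply: dB => i iD'; rewrite /mask.
    by have [iD|//] := boolP (i.1 \in D); rewrite /= fg// mem_filter iD.
  rewrite -[LHS]/(P (mask D @^-1` B)) (PE dmB).
  rewrite -[RHS]/(L D (encode @^-1` (mask D @^-1` B))).
  apply/esym/L_consistent.
  + by move=> j /mapP[i]; rewrite mem_filter => /andP[iD _] ->.
  + by apply: measurable_encode; exists [seq i <- D' | i.1 \in D].
  + exact: depends_encode.
- by move=> _; rewrite -[ltLHS]/(P (mask D @^-1` setT)) preimage_setT PT ltry.
Qed.

Let Q := pushforward P decode.

Let Q0 : Q set0 = 0%E.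
Proof. by rewrite /Q /pushforward preimage_set0 measure0. Qed.

Let Q_ge0 A : (0 <= Q A)%E.
Proof. exact: measure_ge0. Qed.

Let Q_sigma_additive : semi_sigma_additive Q.
Proof.
exact: measure_semi_sigma_additive.
Qed.

HB.instance Definition _ := isMeasure.Build _ _ _ Q Q0 Q_ge0 Q_sigma_additive.

Let QT : Q setT = 1%E.
Proof.
by rewrite /Q /pushforward preimage_setT (@PE [::])// preimage_setT probability_setT.
Qed.

HB.instance Definition _ := Measure_isProbability.Build _ _ _ Q QT.

Theorem kolmogorov_extension : exists Q : probability Omega R,
  forall D (E : set Omega), measurable E -> depends D E -> Q E = L D E.
Proof.
exists Q => D E mE dE.
have decode_mask f : {in D, decode (mask D f) =1 decode f}.
  by move=> j jD; congr dec; apply/funext => k; rewrite /mask/= jD.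
have decode_encode w : {in D, decode (mask D (encodeM w)) =1 w}.
  move=> j jD; rewrite decode_mask// -[RHS]bitK; congr dec.
have mdE : measurable (decode @^-1` E).
  by rewrite -[X in measurable X]setTI; exact: measurable_decode.
transitivity (P (mask D @^-1` (decode @^-1` E))).
  congr (P _); apply/seteqP; split => f /=; apply: dE => j jD.
    by rewrite decode_mask.
  by rewrite decode_mask.
rewrite P_mask//; congr (L D _).
by apply/seteqP; split => w /=; apply: dE => j jD; rewrite decode_encode.
Qed.

End kolmogorov_extension.

(** * The canonical Markov process *)

Section markov_process_existence.
Context d (X : measurableType d) (R : realType) (K : choiceType).
Variables (bit : K -> X -> bool) (dec : product_space K bool -> X).
Hypothesis mbit : forall k, measurable_fun setT (bit k).
Hypothesis mdec : measurable_fun setT dec.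
Hypothesis bitK : forall x, dec (bit^~ x) = x.
Variables (nu : probability X R) (p : R -> R.-pker X ~> X).
Hypothesis psg : transition_semigroup p.
Local Notation Omega := (product_space R X).
Local Notation law := (law nu p).
Implicit Types (D : seq R) (E : set Omega).

Let gt_trans : transitive (>%R : rel R).
Proof. by move=> y x z yx zy; exact: lt_trans zy yx. Qed.

(** The Giry monad only provides subprobabilities, so the total mass has to be computed. *)
Lemma law_setT D : law D setT = 1%E.
Proof.
have I d' (T : measurableType d') (m : {measure set T -> \bar R}) :
    (\int[m]_w cst 1%E w = m setT)%E.
  by rewrite (integral_cst _ measurableT) mul1e.
rewrite -I; elim: D => [|t D IH].
  rewrite integral_law_nil//; exact: (etrans (I _ _ nu) (probability_setT nu)).
rewrite integral_law_cons// -[RHS]IH; apply: eq_integral => w _.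
pose k := p (t - head 0 D).
exact: (etrans (I _ _ (k _)) (prob_kernel (s := k) (w (head 0 D)))).
Qed.

(* Negative times are irrelevant: the coordinate at [t] is that at [`|t|]. *)
Definition abs_path (w : Omega) : Omega := fun t => w `|t|.

Lemma measurable_abs_path : measurable_fun setT abs_path.
Proof. by apply: measurable_product => t; exact: measurable_coord. Qed.

Definition abs_times D : seq R := rev (sort <=%R (undup [seq `|t| | t <- D])).

Lemma mem_abs_times D t : (t \in abs_times D) = (t \in [seq `|t| | t <- D]).
Proof. by rewrite mem_rev mem_sort mem_undup. Qed.

Lemma times_abs_times D : times (abs_times D).
Proof.
apply/andP; split.
  by rewrite rev_sorted lt_sorted_uniq_le sort_uniq undup_uniq sort_le_sorted.
by apply/allP => t; rewrite mem_abs_times => /mapP[r _ ->] /=.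
Qed.

Lemma abs_times_id D : times D -> abs_times D = D.
Proof.
move=> tD; have /andP[sD pD] := tD.
have /andP[sD' _] := times_abs_times D.
apply: (@irr_sorted_eq _ >%R) => //; first by move=> x; rewrite /= ltxx.
move=> t; rewrite mem_abs_times; apply/mapP/idP => [[r rD ->]|rD].
  by rewrite ger0_norm//; exact: (allP pD).
by exists t => //; rewrite ger0_norm//; exact: (allP pD).
Qed.

Lemma depends_abs_path D E : depends D E ->
  depends (abs_times D) (abs_path @^-1` E).
Proof.
move=> dE w w' ww'; apply: dE => t tD; apply: ww'.
by rewrite mem_abs_times; apply/mapP; exists t.
Qed.

Lemma measurable_abs_preimage E : measurable E -> measurable (abs_path @^-1` E).
Proof.
by move=> mE; rewrite -[X in measurable X]setTI; exact: measurable_abs_path.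
Qed.

(** The extension theorem asks for a law at every list of reals; [abs_times] produces from it a list
    satisfying [times]. *)
Definition fdd D : set Omega -> \bar R :=
  giry_map measurable_abs_path (law (abs_times D)).

HB.instance Definition _ D := SubProbability.on (fdd D).

Let fddT D : fdd D setT = 1%E.
Proof. exact: law_setT. Qed.

HB.instance Definition _ D := isProbability.Build _ _ _ (fdd D) (fddT D).

Lemma fdd_consistent D D' E : {subset D <= D'} -> measurable E -> depends D E ->
  fdd D' E = fdd D E.
Proof.
move=> DD' mE dE; rewrite -[LHS]/(law (abs_times D') (abs_path @^-1` E)).
rewrite -[RHS]/(law (abs_times D) (abs_path @^-1` E)).
apply: (law_subset nu psg).
- exact: times_abs_times.
- exact: times_abs_times.
- by move=> t; rewrite !mem_abs_times => /mapP[r /DD' rD' ->]; apply/mapP; exists r.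
- exact: measurable_abs_preimage.
- exact: depends_abs_path.
Qed.

Lemma fddE D E : times D -> depends D E -> fdd D E = law D E.
Proof.
move=> tD dE; rewrite -[LHS]/(law (abs_times D) (abs_path @^-1` E)) abs_times_id//.
congr (law D _).
have /andP[_ pD] := tD.
by apply/seteqP; split => w /=; apply: dE => t tD';
  rewrite /abs_path ger0_norm//; exact: (allP pD).
Qed.

(** * Marginals and Markov property of the path measure *)

Section path_measure.
Variable Q : probability Omega R.
Hypothesis QE : forall D E, measurable E -> depends D E -> Q E = fdd D E.

(** Resetting a path to [point] outside [D] makes the preimage of every measurable set depend on
    [D]. The images of [Q] and [law D] under this map are therefore equal measures, and [g] does not
    see the difference. *)
Lemma integral_path_measure D (g : Omega -> \bar R) : times D ->
  measurable_fun setT g -> (forall w, 0 <= g w)%E ->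
  (forall w w', {in D, w =1 w'} -> g w = g w') ->
  (\int[Q]_w g w = \int[law D]_w g w)%E.
Proof.
move=> tD mg g0 gD.
pose restrict (w : Omega) : Omega := fun t => if t \in D then w t else point.
have mr : measurable_fun setT restrict.
  apply: measurable_product => t; rewrite /restrict; case: (t \in D) => //.
  exact: measurable_coord.
have gr : g = g \o restrict.
  apply/funext => w; by apply: gD => t tD'; rewrite /restrict tD'.
transitivity (\int[Q]_w (g \o restrict) w)%E; first by rewrite -gr.
transitivity (\int[law D]_w (g \o restrict) w)%E; last by rewrite -gr.
rewrite -[LHS](giry_int_map mr (Q : subprobability _ _) mg g0).
rewrite -[RHS](giry_int_map mr (law D) mg g0).
apply: eq_measure_integral => E mE _.
have mrE : measurable (restrict @^-1` E).
  by rewrite -[X in measurable X]setTI; exact: mr.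
have dE : depends D (restrict @^-1` E).
  move=> w w' ww'; rewrite /preimage/= (_ : restrict w = restrict w')//.
  by apply/funext => t; rewrite /restrict; have [/ww'|//] := boolP (t \in D).
rewrite -[LHS]/(Q (restrict @^-1` E)) (QE mrE dE).
exact: fddE.
Qed.

Let measurable_coord_preimage t (A : set X) : measurable A ->
  measurable [set w : Omega | A (w t)].
Proof.
by move=> mA; rewrite -[X in measurable X]setTI; exact: measurable_coord.
Qed.

Let law_integral D E : measurable E ->
  law D E = (\int[law D]_w (\1_E w)%:E)%E.
Proof. by move=> mE; rewrite integral_indic// setIT. Qed.

Lemma path_measure_coord t (A : set X) : 0 <= t -> measurable A ->
  Q [set w : Omega | A (w t)] = (\int[nu]_x p t x A)%E.
Proof.
move=> t0 mA; set F := [set w | _].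
have mF : measurable F by exact: measurable_coord_preimage.
have dF : depends [:: t] F by move=> w w' ww'; rewrite /F/= ww'// inE.
have g0 (w : Omega) : (0 <= (\1_F w)%:E :> \bar R)%E by rewrite lee_fin.
have mg : measurable_fun setT (fun w : Omega => (\1_F w)%:E : \bar R).
  exact/measurable_EFinP.
rewrite (QE mF dF) fddE//; last by rewrite /times /= t0.
rewrite law_integral// (integral_law_cons nu p t [::] mg g0).
rewrite (integral_law_nil nu p (measurable_integral_redraw p _ t mg g0)); last first.
  by move=> w; exact: integral_ge0.
congr (integral _ _ _); apply/funext => x; rewrite /= subr0.
rewrite -[A in RHS]setIT -integral_indic//; congr (integral _ _ _).
by apply/funext => y; rewrite !indicE /F /upd; congr ((_ : bool)%:R%:E);
  apply/idP/idP; rewrite !inE /= eqxx.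
Qed.

(** Unlike preimages under single coordinates, these events are stable under intersection, as
    Dynkin's theorem requires. *)
Definition past (s : R) : set (set Omega) := [set E : set Omega | exists D : seq R,
  [/\ times D, all (<= s) D, measurable E & depends D E]].

Lemma past_markov s t E (A : set X) : 0 <= s -> 0 <= t -> past s E -> measurable A ->
  Q (E `&` [set w : Omega | A (w (s + t))]) = (\int[Q]_(w in E) p t (w s) A)%E.
Proof.
move=> s0 t0 [D [tD Ds mE dE]] mA; set F := [set w | _].
have mF : measurable F by exact: measurable_coord_preimage.
(* For [t = 0] the times [s] and [s + t] coincide and cannot both stand in a strictly decreasing
   list; here [p 0] is the Dirac kernel. *)
have [t00|tn0] := eqVneq t 0.
  transitivity (\int[Q]_(w in E) (\1_F w)%:E)%E.
    by rewrite setIC; apply/esym/(integral_indic Q mE mF).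
  congr (integral _ _ _); apply/funext => w; rewrite t00 (proj1 psg)//.
  rewrite /dirac; congr (_%:E); rewrite /F t00 addr0.
  by rewrite !indicE; congr ((_ : bool)%:R); apply/idP/idP; rewrite !inE.
have {t0 tn0}t0 : 0 < t by rewrite lt_neqAle eq_sym tn0.
(* With [s] at the head, the value at [s + t] is redrawn from the value at [s], even if [D] does not
   contain [s]. *)
pose D1 := s :: [seq r <- D | r < s].
have DD1 : {subset D <= D1}.
  move=> r rD; rewrite inE mem_filter rD andbT -le_eqVlt.
  exact: (allP Ds).
have /andP[sD pD] := tD.
have tD1 : times D1.
  apply/andP; split; last first.
    rewrite /= s0; apply/allP => r; rewrite mem_filter => /andP[_ rD].
    exact: (allP pD).
  rewrite /= (path_sortedE gt_trans) (sorted_filter gt_trans)// andbT.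
  by apply/allP => r; rewrite mem_filter => /andP[].
have D1s : all (<= s) D1.
  rewrite /= lexx; apply/allP => r; rewrite mem_filter => /andP[/ltW].
  by [].
have tD2 : times (s + t :: D1).
  have /andP[sD1 pD1] := tD1; apply/andP; split.
    by rewrite /= ltrDl t0.
  by rewrite /= addr_ge0// ?(ltW t0)//; exact: pD1.
have D1n : s + t \notin D1.
  by apply/negP => /(allP D1s) /=; rewrite leNgt ltrDl t0.
have dE1 : depends D1 E by exact: depends_subset dE.
have dEF : depends (s + t :: D1) (E `&` F).
  move=> w w' ww' [Ew Fw]; split.
    by apply: dE1 Ew => r rD; rewrite ww'// inE rD orbT.
  by rewrite /F/= -ww'// inE eqxx.
have mEF : measurable (E `&` F) by exact: measurableI.
pose f (w : Omega) := p t (w s) A.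
have mf : measurable_fun setT f.
  have mp : measurable_fun setT (fun x => p t x A) by exact: measurable_kernel.
  exact: measurableT_comp mp (measurable_coord s).
have f0 w : (0 <= f w)%E by [].
transitivity (\int[Q]_w (f \_ E) w)%E; 
  last exact: esym (@integral_mkcond _ _ _ Q E f).
rewrite (@integral_path_measure D1)//; last 3 first.
- by rewrite -(measurable_restrictT _ mE); exact: measurable_funTS.
- by move=> w; rewrite erestrict_ge0.
- move=> w w' ww'; rewrite /patch (dependsE dE1 ww') /f ww'// inE eqxx //.
have g0 (w : Omega) : (0 <= (\1_(E `&` F) w)%:E :> \bar R)%E by rewrite lee_fin.
have mg : measurable_fun setT (fun w : Omega => (\1_(E `&` F) w)%:E : \bar R).
  exact/measurable_EFinP.
rewrite (QE mEF dEF) fddE// law_integral// (integral_law_cons nu p _ D1 mg g0).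
congr (integral _ _ _); apply/funext => w; rewrite [head _ _]/= addrAC subrr add0r.
have updE y : (upd (s + t) (w, y) \in E) = (w \in E).
  apply: dependsE dE1 _ => r rD; rewrite /upd /=; case: eqVneq => // rst.
  by rewrite -rst rD in D1n.
rewrite /patch; have [wE|wE] := boolP (w \in E).
  rewrite /f -[A in RHS]setIT -integral_indic//; congr (integral _ _ _).
  by apply/funext => y; rewrite indicI /= !indicE updE wE mul1r; congr ((_ : bool)%:R%:E);
    apply/idP/idP; rewrite !inE /F /upd /= eqxx.
apply: integral0_eq => y _.
by rewrite indicI /= !indicE updE (negPf wE) mul0r.
Qed.

Lemma past_setI_closed s : setI_closed (past s).
Proof.
move=> E E' [D [tD Ds mE dE]] [D' [tD' D's mE' dE']].
have mem r : (r \in D ++ D') -> 0 <= r <= s.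
  rewrite mem_cat => /orP[rD|rD'].
    by have /andP[_ /allP/(_ _ rD)-> ] := tD; exact: (allP Ds).
  by have /andP[_ /allP/(_ _ rD')-> ] := tD'; exact: (allP D's).
exists (abs_times (D ++ D')); split.
- exact: times_abs_times.
- apply/allP => r; rewrite mem_abs_times => /mapP[q /mem/andP[q0 qs] ->].
  by rewrite /= ger0_norm.
- exact: measurableI.
- have sub r : r \in D ++ D' -> r \in abs_times (D ++ D').
    move=> rD; rewrite mem_abs_times; apply/mapP; exists r => //.
    by have /andP[r0 _] := mem _ rD; rewrite ger0_norm.
  move=> w w' ww' [Ew E'w]; split.
    by apply: dE Ew => r rD; apply/ww'/sub; rewrite mem_cat rD.
  by apply: dE' E'w => r rD; apply/ww'/sub; rewrite mem_cat rD orbT.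
Qed.

Lemma past_setT s : past s setT.
Proof. by exists [::]; split. Qed.

Lemma natural_filtration_past s E : 0 <= s ->
  natural_filtration (fun t (w : Omega) => w t) s E -> <<s past s >> E.
Proof.
move=> s0; apply: sub_smallest2r; first exact: smallest_sigma_algebra.
move=> _ [r [A [r0 rs mA ->]]]; exists [:: r]; split.
- by rewrite /times /= r0.
- by rewrite /= rs.
- exact: measurable_coord_preimage.
- by move=> w w' ww'; rewrite /preimage/= ww'// inE.
Qed.

Lemma path_measure_markov : markov_process p Q (fun t w => w t).
Proof.
split => [t _|s t E A s0 t0 /(natural_filtration_past s0) FE mA].
  exact: measurable_coord.
pose F := [set w : Omega | A (w (s + t))].
pose f (w : Omega) := p t (w s) A.
have mF : measurable F by exact: measurable_coord_preimage.
have mf : measurable_fun setT f.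
  have mp : measurable_fun setT (fun x => p t x A) by exact: measurable_kernel.
  exact: measurableT_comp mp (measurable_coord s).
have f0 w : (0 <= f w)%E by [].
(* The induction runs over [<<s past s >>], so measurability in [Omega] has to be carried along. *)
pose P (S : set Omega) := measurable S /\ Q (S `&` F) = (\int[Q]_(w in S) f w)%E.
have PG : past s `<=` P.
  move=> S pS; split; first by have [D []] := pS.
  exact: past_markov.
have PT : P setT by exact/PG/past_setT.
suff : P E by case.
apply: (@dynkin_induction _ (g_sigma_algebraType (past s)) (past s) P) FE => //.
- exact: past_setI_closed.
- move=> S _ [mS PS]; have mSC := measurableC mS; split => //.
  have [_] := PT; rewrite setTI.
  have -> : (\int[Q]_w f w =
      \int[Q]_(w in S) f w + \int[Q]_(w in ~` S) f w)%E.
    have := @ge0_integral_setU _ _ _ Q S (~` S) mS mSC f.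
    rewrite setUv; apply => //.
    by apply/disj_setPS; rewrite setICr.
  have -> : Q F = (Q (S `&` F) + Q (~` S `&` F))%E.
    rewrite -[F in LHS]setTI -(setUv S) setIUl.
    apply: (@measureU _ _ _ Q); [exact: measurableI|exact: measurableI|].
    by rewrite setIACA setICr set0I.
  (* Finiteness allows the cancellation in the extended reals. *)
  have fQ : Q (S `&` F) \is a fin_num.
    by apply: fin_num_measure; exact: measurableI.
  rewrite -PS => /(congr1 (fun z => z - Q (S `&` F))%E).
  by rewrite ![(Q (S `&` F) + _)%E]addeC !addeK.
- move=> S _ tS PS; have mS n : measurable (S n : set Omega) by case: (PS n).
  split; first exact: bigcup_measurable.
  have -> := @ge0_integral_bigcup _ _ _ Q S f mS (measurable_funTS mf)
    (fun w _ => f0 w) tS.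
  rewrite setI_bigcupl; apply: etrans (@measure_semi_bigcup _ _ _ Q _ _ _ _) _.
  + by move=> n; exact: measurableI.
  + exact: trivIset_setIr.
  + by apply: bigcup_measurable => n _; exact: measurableI.
  + by apply: eq_eseriesr => n _; case: (PS n).
Qed.

End path_measure.

Theorem markov_process_exists : exists Q : probability Omega R,
  markov_process p Q (fun t w => w t) /\
  forall t A, 0 <= t -> measurable A ->
    Q [set w : Omega | A (w t)] = (\int[nu]_x p t x A)%E.
Proof.
have [Q QE] := kolmogorov_extension mbit mdec bitK fdd_consistent.
exists Q; split; first exact: path_measure_markov.
by move=> t A; exact: path_measure_coord.
Qed.

End markov_process_existence.

(** * Coding of complete separable metric spaces *)

Lemma half_expr_lt (R : realType) (e : R) : 0 < e -> exists k, 2^-1 ^+ k < e.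
Proof.
move=> e0; have [k _ /(_ k (leqnn k))] := near_infty_natSinv_expn_lt (PosNum e0).
by rewrite /= div1r -exprVn; exists k.
Qed.

(* A point is coded by the bits [|v x - v (c n)| < 2^-k]; it is decoded as a
   limit of the first [c n] at distance less than [2^-k]. *)
Section polish_coding.
Context d (X : measurableType d) (R : realType) (V : normedModType R).
Variables (v : X -> V) (c : nat -> X).
Hypothesis v_inj : injective v.
Hypothesis measurableX :
  @measurable _ X = <<s [set v @^-1` U | U in [set U : set V | open U]] >>.
(** Points within [2^-k] and [2^-(k+1)] of a common point are at most [2 * 2^-k] apart; such steps
    from [k] onwards add up to [4 * 2^-k]. *)
Hypothesis v_complete : forall x : nat -> X,
  (forall k, `|v (x k.+1) - v (x k)| <= 2 * 2^-1 ^+ k) ->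
  exists l, forall k, `|v (x k) - v l| <= 4 * 2^-1 ^+ k.
Hypothesis c_dense : forall x (e : R), 0 < e -> exists n, `|v x - v (c n)| < e.

Let bit (i : nat * nat) (x : X) : bool := `|v x - v (c i.2)| < 2^-1 ^+ i.1.

Let measurable_bit i : measurable_fun setT (bit i).
Proof.
apply: (measurable_fun_bool true); rewrite setTI measurableX.
apply: sub_sigma_algebra.
exists [set y | `|y - v (c i.2)| < 2^-1 ^+ i.1]; last first.
  by apply/seteqP; split.
rewrite (_ : mkset _ = ball (v (c i.2)) (2^-1 ^+ i.1 : R)).
  by apply: ball_open; rewrite exprn_gt0// invr_gt0.
by apply/seteqP; split => y; rewrite -ball_normE /ball_ /= distrC.
Qed.

Local Notation code := (product_space (nat * nat)%type bool).

Let is_first (w : code) k n := w (k, n) /\ forall m, (m < n)%N -> ~~ w (k, m).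

Let first (w : code) k : nat := xget 0%N [set n | is_first w k n].

Let first_ex (w : code) k : (exists n, w (k, n)) -> is_first w k (first w k).
Proof.
move=> wk; apply: (@xgetPex _ 0%N [set n | is_first w k n]).
exists (ex_minn wk); case: ex_minnP => n wn nmin; split => // m mn.
by apply/negP => /nmin; rewrite leqNgt mn.
Qed.

Let measurable_w i : measurable [set w : code | w i].
Proof.
have mi : measurable_fun [set: code] (fun w => w i) := measurable_coord i.
by have := mi measurableT [set true] Logic.I; rewrite setTI.
Qed.

Let measurable_first k n : measurable [set w | first w k = n].
Proof.
have mF m : measurable [set w | is_first w k m].
  rewrite (_ : [set w | _] = [set w : code | w (k, m)] `&`
      \bigcap_(j in [set j | (j < m)%N]) ~` [set w : code | w (k, j)]).
    apply: measurableI => //; apply: bigcap_measurableType.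
    by move=> j _; exact: measurableC.
  by apply/seteqP; split => w [wm Hm]; split => // j /Hm /negP.
have mN : measurable (\bigcap_m ~` [set w | is_first w k m]).
  by apply: bigcap_measurableType => // m _; exact: measurableC.
have firstN w : (\bigcap_m ~` [set w | is_first w k m]) w -> first w k = 0%N.
  by move=> wN; apply: xgetPN => m; exact: wN.
have firstP w m : is_first w k m -> first w k = m.
  move=> wm; have [wf fmin] : is_first w k (first w k).
    by apply: first_ex; exists m; exact: wm.1.
  have [wm' mmin] := wm; apply/eqP; rewrite eqn_leq leqNgt [X in _ && X]leqNgt.
  apply/andP; split; apply/negP; first by move/fmin; rewrite wm'.
  by move/mmin; rewrite wf.
have dich w : (exists m, is_first w k m) \/
    (\bigcap_m ~` [set w | is_first w k m]) w.
  have [h|h] := pselect (exists m, is_first w k m); first by left.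
  by right => m _ wm; apply: h; exists m.
(* The value 0 is also the default of [first] when no bit is set at level [k]. *)
have [->|n0] := eqVneq n 0%N.
  rewrite (_ : [set w | _] =
      [set w | is_first w k 0] `|` \bigcap_m ~` [set w | is_first w k m]).
    exact: measurableU.
  apply/seteqP; split => w; last by case=> [/firstP|/firstN].
  move=> /= w0; have [[m wm]|] := dich w; last by right.
  by left; rewrite /= -w0 (firstP _ _ wm).
rewrite (_ : [set w | _] = [set w | is_first w k n])//.
apply/seteqP; split => w /=; last exact: firstP.
move=> wn; have [[m wm]|/firstN] := dich w; last by rewrite wn => /eqP; rewrite (negPf n0).
by rewrite -wn (firstP _ _ wm).
Qed.

(* The jumps that are too large are skipped so that [v (c (index w k))]
   converges for every code [w], and not only for those of points of [X]. *)
Let step k (m n : nat) : nat :=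
  if `|v (c n) - v (c m)| <= 2 * 2^-1 ^+ k then n else m.

Let index (w : code) := fix index k :=
  if k is k'.+1 then step k' (index k') (first w k) else first w 0.

Let measurable_index k n : measurable [set w | index w k = n].
Proof.
elim: k n => [|k IH] n; first exact: measurable_first.
rewrite (_ : [set w | _] = \bigcup_i \bigcup_(j in [set j | step k i j = n])
   ([set w | index w k = i] `&` [set w | first w k.+1 = j])).
  apply: bigcupT_measurable => i; apply: bigcup_measurable => j _.
  exact: measurableI.
apply/seteqP; split => w /=.
  by move=> wn; exists (index w k) => //; exists (first w k.+1).
by case=> i _ [j ijn] [/= -> ->].
Qed.

Let index_step w k :
  `|v (c (index w k.+1)) - v (c (index w k))| <= 2 * 2^-1 ^+ k.
Proof.
rewrite /= /step; case: ifPn => // _.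
by rewrite subrr normr0 mulr_ge0// exprn_ge0// invr_ge0.
Qed.

Let decode_ex (w : code) :
  {l | forall k, `|v (c (index w k)) - v l| <= 4 * 2^-1 ^+ k}.
Proof.
apply: cid; apply: (v_complete (x := fun k => c (index w k))) => k.
exact: index_step.
Qed.

Let decode w := sval (decode_ex w).

Let decodeP w k : `|v (c (index w k)) - v (decode w)| <= 4 * 2^-1 ^+ k.
Proof. exact: (svalP (decode_ex w)). Qed.

Let geometric_lt (e : R) : 0 < e -> exists k, 8 * 2^-1 ^+ k < e.
Proof.
move=> e0; have e80 : 0 < e / 8 by rewrite divr_gt0.
have [k ke] := half_expr_lt e80; exists k.
by rewrite mulrC -ltr_pdivlMr.
Qed.

(** By the uniform rate [decodeP], [v (decode w)] lies in an open [U] exactly when, for some [k],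
    the closed ball of radius [4 * 2^-k] around the approximant lies in [U]. This is a countable
    condition on [index]; a point of that ball is within [8 * 2^-k] of the limit. *)
Let measurable_decode : measurable_fun setT decode.
Proof.
apply: (@measurability _ _ _ X setT decode
  [set v @^-1` U | U in [set U : set V | open U]]) => // _ [_ [U oU <-] <-].
rewrite setTI (_ : _ @^-1` _ = \bigcup_k \bigcup_(n in
    [set n | forall y, `|v (c n) - y| <= 4 * 2^-1 ^+ k -> U y])
    [set w | index w k = n]).
  by apply: bigcupT_measurable => k; apply: bigcup_measurable => n _.
apply/seteqP; split => w /=; last first.
  by case=> k _ [n Un wn]; apply: Un; rewrite -wn.
move=> Uw; have /nbhs_ballP[e /= e0 eU] : nbhs (v (decode w)) U.
  exact: open_nbhs_nbhs.
have [k ke] := geometric_lt e0; exists k => //; exists (index w k) => // y wy.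
apply: eU; rewrite -ball_normE /ball_ /=; apply: le_lt_trans ke.
rewrite -(subrKA (v (c (index w k)))) (le_trans (ler_normD _ _))//.
have := decodeP w k; rewrite distrC => wd.
by rewrite (le_trans (lerD wd wy))// -mulrDl -natrD.
Qed.

(** No jump is skipped for the code of a point: consecutive approximants are both close to [x]. *)
Let index_code x k : index (bit^~ x) k = first (bit^~ x) k.
Proof.
have firstE j : `|v x - v (c (first (bit^~ x) j))| < 2^-1 ^+ j.
  have [] // : is_first (bit^~ x) j (first (bit^~ x) j).
  by apply: first_ex; apply: c_dense; rewrite exprn_gt0// invr_gt0.
elim: k => //= k ->; rewrite /step ifT//.
rewrite -(subrKA (v x)) (le_trans (ler_normD _ _))// distrC.
rewrite (_ : 2 * _ = 2^-1 ^+ k + 2^-1 ^+ k); last by rewrite mulr_natl.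
rewrite lerD ?(ltW (firstE _))// (le_trans (ltW (firstE _)))//.
by rewrite exprS ler_piMl ?exprn_ge0 ?invr_ge0// invf_le1// ler1n.
Qed.

Let bitK x : decode (bit^~ x) = x.
Proof.
apply: v_inj; apply/eqP; rewrite -subr_eq0 -normr_le0.
apply/ler_addgt0Pl => e /geometric_lt[k ke]; rewrite addr0.
have [xk _] : is_first (bit^~ x) k (first (bit^~ x) k).
  by apply: first_ex; apply: c_dense; rewrite exprn_gt0// invr_gt0.
have := decodeP (bit^~ x) k; rewrite index_code distrC => dk.
rewrite -(subrKA (v (c (first (bit^~ x) k)))) (le_trans (ler_normD _ _))//.
rewrite /bit /= distrC in xk; rewrite (le_trans _ (ltW ke))//.
rewrite (le_trans (lerD dk (ltW xk)))//.
have : 0 <= 2^-1 ^+ k :> R by rewrite exprn_ge0// invr_ge0.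
lra.
Qed.

Lemma polish_coding : exists (bit : nat * nat -> X -> bool) (decode : code -> X),
  [/\ forall i, measurable_fun setT (bit i), measurable_fun setT decode &
      forall x, decode (bit^~ x) = x].
Proof. by exists bit, decode. Qed.

End polish_coding.

(** * Completeness and separability of the cone *)

Section inner_product_facts.
Context (R : realType) (V : innerProductType R).
Implicit Types x y z : V.

Lemma cauchy_schwarz x y : `|inner x y| <= `|x| * `|y|.
Proof.
rewrite -(@ler_pXn2r _ 2)// ?nnegrE ?mulr_ge0// exprMn -!inner_norm.
rewrite real_normK ?num_real//.
have [y0|y0] := eqVneq (inner y y) 0.
  by rewrite (inner_eq0 y0) (innerC x) !inner0l expr0n/= mulr0.
have yy : 0 < inner y y by rewrite lt_def y0 inner_ge0.
pose a := - (inner x y / inner y y).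
have := inner_ge0 (a *: y + x).
rewrite !(innerDl, innerDr, innerZl, innerZr) (innerC y x).
rewrite (_ : _ + _ = inner x x - inner x y ^+ 2 / inner y y); last first.
  by rewrite /a; field.
by rewrite subr_ge0 ler_pdivrMr.
Qed.

Lemma inner_suml (I : Type) (r : seq I) (P : pred I) (f : I -> V) y :
  inner (\sum_(i <- r | P i) f i) y = \sum_(i <- r | P i) inner (f i) y.
Proof.
elim/big_rec2: _ => [|i a b _ <-]; first exact: inner0l.
by rewrite innerDl.
Qed.

Lemma cvg_innerl (f : nat -> V) l y : f @ \oo --> l ->
  (fun n => inner (f n) y) @ \oo --> (inner l y : R^o).
Proof.
move=> fl; apply/cvgrPdist_lt => e e0.
have y1 : 0 < `|y| + 1 by rewrite ltr_wpDl.
have /cvgrPdist_lt/(_ (e / (`|y| + 1)) (divr_gt0 e0 y1)) := fl.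
apply: filterS => n; rewrite ltr_pdivlMr// => fn.
rewrite -innerBl (le_lt_trans (cauchy_schwarz _ _))// (le_lt_trans _ fn)//.
by rewrite ler_wpM2l// lerDl.
Qed.

Lemma sqr_normD_le x y : `|x + y| ^+ 2 <= 2 * `|x| ^+ 2 + 2 * `|y| ^+ 2.
Proof. by rewrite -!inner_norm inner_parallelogram. Qed.

End inner_product_facts.

Section basis_sequence.
Context (R : realType) (H : hilbertType R).
Hypothesis Hsep : separable H.
Local Notation onb := (@onb R H).

Lemma separable_seq : exists c : nat -> H,
  forall x (e : R), 0 < e -> exists n, `|x - c n| < e.
Proof.
have [D [/countable_injP[g g_inj] Ddense]] := Hsep.
exists (fun n => xget 0 [set y | D y /\ g y = n]) => x e e0.
have [y [xy Dy]] : (ball x e `&` D) !=set0.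
  by apply: Ddense; [exists x; exact: ballxx|exact: ball_open].
exists (g y).
have [Dz gz] := @xgetI _ 0 [set z | D z /\ g z = g y] y (conj Dy erefl).
rewrite (g_inj _ _ _ _ gz) ?inE//.
by move: xy; rewrite -ball_normE.
Qed.

(** Distinct basis vectors are at distance [sqrt 2], so no point of the dense sequence is within
    [1/2] of two of them. *)
Lemma onb_inj : exists g : H -> nat, {in onb &, injective g}.
Proof.
have [c cP] := separable_seq.
have h0 : 0 < 2^-1 :> R by rewrite invr_gt0.
pose g e := sval (cid (cP e _ h0)).
have gP e : `|e - c (g e)| < 2^-1 by rewrite /g; case: cid.
exists g => e f /set_mem Ee /set_mem Ef gef.
apply: contrapT => ef; have [onb1 onb0 _] := @onbP R H.
have : `|e - f| ^+ 2 = 2.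
  by rewrite -inner_norm !(innerBl, innerBr) !onb1// (innerC f) !onb0//; ring.
have ef1 : `|e - f| < 1.
  rewrite -(subrKA (c (g e))) (le_lt_trans (ler_normD _ _))//.
  have := gP f; rewrite -gef distrC => gf.
  by have := gP e; lra.
have : `|e - f| ^+ 2 < 1 by rewrite expr_lt1.
by move=> /[swap] ->; lra.
Qed.

(* An enumeration of [onb], padded with zeros when the basis is finite. *)
Definition basis_sequence (u : nat -> H) := [/\
  forall i j, i <> j -> inner (u i) (u j) = 0,
  forall i, u i = 0 \/ inner (u i) (u i) = 1,
  forall x, (forall i, inner x (u i) = 0) -> x = 0 &
  forall f : H -> R, (forall e, 0 <= f e) -> f 0 = 0 ->
    (\esum_(e in onb) (f e)%:E = \sum_(n <oo) (f (u n))%:E)%E].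

Lemma basis_sequence_ex : exists u, basis_sequence u.
Proof.
have [g g_inj] := onb_inj; have [onb1 onb0 onbT] := @onbP R H.
pose u n := xget 0 [set e | onb e /\ g e = n].
have uP n : (onb (u n) /\ g (u n) = n) \/ u n = 0.
  rewrite /u; case: xgetP => [e _ [Ee gE]|]; first by left.
  by right.
have ug e : onb e -> u (g e) = e.
  move=> Ee; have [Eu gu] := @xgetI _ 0 [set f | onb f /\ g f = g e] e (conj Ee erefl).
  by apply: g_inj; rewrite ?inE.
exists u; split.
- move=> i j ij; case: (uP i) => [[Ei gi]|->]; last exact: inner0l.
  case: (uP j) => [[Ej gj]|->]; last by rewrite innerC inner0l.
  by apply: onb0 => // uij; apply: ij; rewrite -gi -gj uij.
- by move=> i; case: (uP i) => [[Ei _]|->]; [right; rewrite onb1|left].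
- by move=> x xu; apply: onbT => e Ee; rewrite -(ug e Ee).
- move=> f f0 f00; rewrite nneseries_esumT; last by move=> n; rewrite lee_fin.
  rewrite (@reindex_esum R _ _ (g @` onb) onb u); last first.
    split.
    + by move=> _ /= [e Ee <-]; rewrite ug.
    + by move=> x y /set_mem[e Ee <-] /set_mem[e' Ee' <-]; rewrite !ug// => ->.
    + by move=> e Ee; exists (g e); [exists e|rewrite ug].
  rewrite [LHS]esum_mkcond; apply: eq_esum => n _; case: ifPn => // /negP gn.
  case: (uP n) => [[En gEn]|->]; last by rewrite f00.
  by exfalso; apply: gn; rewrite inE; exists (u n).
Qed.

End basis_sequence.

Lemma cvg_le_cst (R : realType) (f : nat -> R) (l C : R) :
  f @ \oo --> l -> (\forall n \near \oo, f n <= C) -> l <= C.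
Proof.
by move=> fl fC; rewrite -(cvg_lim _ fl)//; apply: limr_le => //; exact: cvgP fl.
Qed.

(** * Bessel and Parseval estimates *)

Section basis_expansion.
Context (R : realType) (H : hilbertType R) (u : nat -> H).
Hypothesis uP : basis_sequence u.
Implicit Types (A B : hs H) (x y : H).

Let u_orth i j : i <> j -> inner (u i) (u j) = 0.
Proof. by have [+ _ _ _] := uP; apply. Qed.

Let u_unit i x : inner x (u i) * inner (u i) (u i) = inner x (u i).
Proof.
have [_ /(_ i) [->|->] _ _] := uP; last by rewrite mulr1.
by rewrite inner0l innerC inner0l mulr0.
Qed.

Let u_le1 i : inner (u i) (u i) <= 1.
Proof. by have [_ /(_ i) [->|->] _ _] := uP; rewrite ?inner0l ?ler01 ?lexx. Qed.

(** Pythagoras, as an inequality because some [u k] may be zero. *)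
Lemma sqr_norm_sum_le (a : nat -> R) m n :
  `|\sum_(m <= k < n) a k *: u k| ^+ 2 <= \sum_(m <= k < n) a k ^+ 2.
Proof.
have [nm|] := leqP n m; first by rewrite !big_geq// normr0 expr0n.
elim: n => // n IH; rewrite ltnS leq_eqVlt => /predU1P[->|mn].
  by rewrite !big_nat1 -inner_norm innerZl innerZr mulrA -expr2 ler_piMr ?sqr_ge0.
rewrite !big_nat_recr ?(ltnW mn)//= -inner_norm innerDl !innerDr.
set S := \sum_(m <= k < n) _ *: _.
have S0 : inner S (a n *: u n) = 0.
  rewrite inner_suml big_nat big1// => k /andP[_ kn].
  by rewrite innerZl innerZr u_orth ?mulr0// => kE; rewrite kE ltnn in kn.
rewrite (innerC _ S) S0 addr0 add0r lerD//; first by rewrite inner_norm IH.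
by rewrite innerZl innerZr mulrA -expr2 ler_piMr ?sqr_ge0.
Qed.

(** Square-summable coefficients make the Fourier series of [y] Cauchy; its sum has the coefficients
    of [y], hence is [y] by totality. *)
Lemma sqr_norm_le_basis y C :
  (forall n, \sum_(0 <= k < n) inner y (u k) ^+ 2 <= C) -> `|y| ^+ 2 <= C.
Proof.
move=> yC; pose v k := inner y (u k) *: u k.
have vcvg : cvgn (series v).
  have w_cvg : cvgn (series (fun k => inner y (u k) ^+ 2)).
    apply: nondecreasing_is_cvgn.
      by apply: nondecreasing_series => k _ _; exact: sqr_ge0.
    by exists C => _ [n _ <-]; exact: yC.
  apply/cauchy_cvgP/cauchy_seriesP => e e0.
  have /cauchy_cvgP/cauchy_seriesP/(_ (e ^+ 2)) := w_cvg.
  rewrite exprn_gt0// => /(_ isT); apply: filterS => -[m n] /= mn.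
  rewrite -(@ltr_pXn2r _ 2)// ?nnegrE ?(ltW e0)//.
  apply: le_lt_trans (sqr_norm_sum_le _ _ _) _.
  exact: le_lt_trans (ler_norm _) mn.
have vl : series v @ \oo --> limn (series v) by [].
set s := limn (series v) in vl.
have su j : inner s (u j) = inner y (u j).
  have vs := @cvg_innerl _ _ _ _ (u j) vl.
  suff vy : (fun n => inner (series v n) (u j)) @ \oo --> (inner y (u j) : R^o).
    by rewrite -(cvg_lim _ vs)// (cvg_lim _ vy).
  apply: cvg_near_cst; exists j.+1 => // n /= jn.
  rewrite /series /= inner_suml big_mkord (bigD1 (Ordinal jn))//= big1 ?addr0.
    by rewrite /v innerZl u_unit.
  move=> i ij; rewrite /v innerZl u_orth ?mulr0// => ijE.
  by move/eqP: ij; apply; exact: val_inj.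
have [_ _ uT _] := uP.
have -> : y = s.
  apply/eqP; rewrite -subr_eq0; apply/eqP/uT => j.
  by rewrite innerBl su subrr.
apply: (@cvg_le_cst _ (fun n => `|series v n| ^+ 2)).
  by rewrite expr2; under eq_fun do rewrite expr2; apply: cvgM; exact: cvg_norm.
by apply: nearW => n; apply: le_trans (sqr_norm_sum_le _ _ _) _; exact: yC.
Qed.

Lemma hilbert_schmidtE (A : H -> H) : A 0 = 0 ->
  (\esum_(e in @onb R H) (`|A e| ^+ 2)%:E =
   \sum_(n <oo) (`|A (u n)| ^+ 2)%:E)%E.
Proof.
move=> A0; have [_ _ _ uE] := uP.
rewrite (uE (fun e => `|A e| ^+ 2))//.
by rewrite A0 normr0 expr0n.
Qed.

Lemma hs0 A : A 0 = 0.
Proof.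
have [lA _ _ _] := hsP A.
by have := lA (-1) 0 0; rewrite scaler0 addr0 scaleN1r addNr.
Qed.

Lemma hs_sqr_norm A :
  ((`|A| ^+ 2)%:E = \sum_(n <oo) (`|A (u n)| ^+ 2)%:E)%E.
Proof.
rewrite -hilbert_schmidtE ?hs0// -inner_norm -[inner A A]/(hs_inner A A).
have [_ _ _ hA] := hsP A.
rewrite hs_innerE rsum_ge0E; [|by move=> e; exact: inner_ge0|exact: hs_summ].
rewrite fineK; last by apply: esum_fin; [move=> e; exact: inner_ge0|exact: hs_summ].
by apply: eq_esum => e _; rewrite inner_norm.
Qed.

Lemma hs_sum_le A n : \sum_(0 <= k < n) `|A (u k)| ^+ 2 <= `|A| ^+ 2.
Proof.
rewrite -lee_fin hs_sqr_norm -sumEFin.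
by apply: nneseries_lim_ge => k _ _; rewrite lee_fin sqr_ge0.
Qed.

Lemma nneseries_le_cst (f : nat -> R) C : (forall k, 0 <= f k) ->
  (forall n, \sum_(0 <= k < n) f k <= C) ->
  (\sum_(n <oo) (f n)%:E <= C%:E)%E.
Proof.
move=> f0 fC; apply: lime_le.
  by apply: is_cvg_nneseries => k _ _; rewrite lee_fin.
by apply: nearW => n; rewrite sumEFin lee_fin.
Qed.

Lemma hs_norm_le A C : (forall n, \sum_(0 <= k < n) `|A (u k)| ^+ 2 <= C) ->
  `|A| ^+ 2 <= C.
Proof.
by move=> AC; rewrite -lee_fin hs_sqr_norm nneseries_le_cst// => k; exact: sqr_ge0.
Qed.

(** By self-adjointness the coefficients of [A x] are [inner x (A (u k))], to which Cauchy-Schwarz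
    applies. *)
Lemma hs_apply_le A x : `|A x| <= `|A| * `|x|.
Proof.
rewrite -(@ler_pXn2r _ 2)// ?nnegrE ?mulr_ge0// exprMn.
have [_ _ sA _] := hsP A.
apply: sqr_norm_le_basis => n.
apply: (@le_trans _ _ (`|x| ^+ 2 * \sum_(0 <= k < n) `|A (u k)| ^+ 2)).
  rewrite mulr_sumr ler_sum// => k _; rewrite sA -exprMn.
  by rewrite -[leLHS]real_normK ?num_real// lerXn2r ?nnegrE ?mulr_ge0// cauchy_schwarz.
by rewrite mulrC ler_wpM2r ?sqr_ge0// hs_sum_le.
Qed.

End basis_expansion.

(** * Separability of the cone *)

Section cone_density.
Context (R : realType) (H : hilbertType R) (u : nat -> H).
Hypotheses (Hsep : separable H) (uP : basis_sequence u).
Local Notation X := (hs_cone H).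

Lemma hsB (A B : hs H) x : (A - B : hs H) x = A x - B x. Proof. by []. Qed.

(** Approximation by simple operators would have to preserve positivity. Instead, for each [k] the
    cone is covered by countably many sets [S k l] of squared diameter at most [8 * 2^-k], and one
    point is chosen from each nonempty set. *)
Lemma hs_cone_dense : exists c : nat -> X,
  forall x (e : R), 0 < e -> exists n, `|op x - op (c n)| < e.
Proof.
have [b bP] := separable_seq Hsep.
pose d k : R := 2^-1 ^+ k.
have d0 k : 0 < d k by rewrite exprn_gt0// invr_gt0.
(* The tolerance per basis vector is scaled so that the head errors sum to at most [d k]; the
   successor avoids a zero denominator for the empty list. *)
pose S k (l : seq nat) : set X := [set A |
  (forall i, (i < size l)%N ->
     `|op A (u i) - b (nth 0%N l i)| ^+ 2 <= d k / (size l).+1%:R) /\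
  `|op A| ^+ 2 - \sum_(0 <= i < size l) `|op A (u i)| ^+ 2 <= d k].
pose c n : X := if (unpickle n : option (nat * seq nat)) is Some kl
  then xget point (S kl.1 kl.2) else point.
exists c => x e e0.
(* The head and the tail of the sum each contribute [4 * d k], by [sqr_normD_le]. *)
have [k ke] : exists k, 8 * d k < e ^+ 2.
  have e8 : 0 < e ^+ 2 / 8 by rewrite divr_gt0// exprn_gt0.
  have [k ke] := half_expr_lt e8; exists k.
  by rewrite mulrC -ltr_pdivlMr.
(* If every tail exceeded [d k], then [hs_norm_le] would bound the squared norm by itself minus
   [d k]. *)
have [N xN] : exists N,
    `|op x| ^+ 2 - \sum_(0 <= i < N) `|op x (u i)| ^+ 2 <= d k.
  apply: contrapT => nN.
  have : `|op x| ^+ 2 <= `|op x| ^+ 2 - d k.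
    apply: (hs_norm_le uP) => n; rewrite lerBrDr -lerBrDl ltW// ltNge.
    by apply/negP => xn; apply: nN; exists n.
  by rewrite lerBrDl gerDr leNgt d0.
have t0 : 0 < d k / N.+1%:R by rewrite divr_gt0.
have bP2 y : exists n, `|y - b n| ^+ 2 <= d k / N.+1%:R.
  have [n yn] : exists n, `|y - b n| < Num.sqrt (d k / N.+1%:R).
    by apply: bP; rewrite sqrtr_gt0.
  exists n; rewrite -[leRHS]sqr_sqrtr ?(ltW t0)//.
  by rewrite lerXn2r ?nnegrE ?sqrtr_ge0// ltW.
pose l := mkseq (fun i => sval (cid (bP2 (op x (u i))))) N.
have sl : size l = N by rewrite size_mkseq.
have Sx : S k l x.
  split; rewrite sl// => i iN; rewrite nth_mkseq//.
  by case: cid.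
exists (pickle (k, l)); rewrite /c pickleK /=.
have Sy := xgetI point Sx; set y := xget point _ in Sy *.
rewrite -(@ltr_pXn2r _ 2)// ?nnegrE ?(ltW e0)//; apply: le_lt_trans ke.
have tail A m : S k l A ->
    \sum_(N <= i < N + m) `|op A (u i)| ^+ 2 <= d k.
  move=> [_]; rewrite sl; apply: le_trans.
  rewrite lerBrDl -big_cat_nat ?leq_addr//=; exact: hs_sum_le.
apply: (hs_norm_le uP) => m.
(* Extended to [N + m] terms, the sum can be split at [N] whatever [m] is. *)
apply: (@le_trans _ _ (\sum_(0 <= i < N + m) `|(op x - op y : hs H) (u i)| ^+ 2)).
  rewrite (@big_cat_nat _ _ _ m 0%N (N + m))//= ?leq_addl// lerDl.
  by apply: sumr_ge0 => i _; exact: sqr_ge0.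
rewrite (@big_cat_nat _ _ _ N)//= ?leq_addr//.
rewrite (_ : 8 * d k = 4 * d k + 4 * d k); last by ring.
apply: lerD.
  apply: (@le_trans _ _ (\sum_(0 <= i < N) 4 * (d k / N.+1%:R))).
    rewrite !big_nat ler_sum// => i /andP[_ iN].
    rewrite -[X in `|X|]/(op x (u i) - op y (u i)).
    rewrite -(subrKA (b (nth 0%N l i))).
    apply: le_trans (sqr_normD_le _ _) _.
    have [/(_ i)] := Sx; rewrite sl => /(_ iN) xi _.
    have [/(_ i)] := Sy; rewrite sl distrC => /(_ iN) yi _.
    move: xi yi; move: (d k / N.+1%:R) => t xi yi.
    lra.
  rewrite sumr_const_nat subn0 -[leLHS]mulr_natr -mulrA ler_wpM2l// -mulrA.
  rewrite ler_piMr ?(ltW (d0 k))// mulrC ler_pdivrMr// mul1r ler_nat.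
  exact: leqnSn.
apply: (@le_trans _ _ (2 * \sum_(N <= i < N + m) `|op x (u i)| ^+ 2 +
    2 * \sum_(N <= i < N + m) `|op y (u i)| ^+ 2)).
  rewrite !mulr_sumr -big_split/= ler_sum// => i _.
  rewrite -[X in `|X|]/(op x (u i) - op y (u i)).
  by apply: le_trans (sqr_normD_le _ _) _; rewrite normrN.
have := tail x m Sx; have := tail y m Sy.
lra.
Qed.

End cone_density.

(** * Completeness of the cone *)

Section cone_completeness.
Context (R : realType) (H : hilbertType R) (u : nat -> H).
Hypothesis uP : basis_sequence u.
Local Notation X := (hs_cone H).
Variable x : nat -> X.
Hypothesis x_step : forall k, `|op (x k.+1) - op (x k)| <= 2 * 2^-1 ^+ k.

Let A k : hs H := op (x k).
Let h k : R := 2^-1 ^+ k.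

Let h_ge0 k : 0 <= h k. Proof. by rewrite exprn_ge0// invr_ge0. Qed.

Let A_dist k m : (k <= m)%N -> `|A m - A k| <= 4 * h k.
Proof.
(* The sharper bound closes the induction: [2 * h m - 4 * h m = - 4 * h m.+1]. *)
move=> km; apply: (@le_trans _ _ (4 * h k - 4 * h m)); last first.
  by rewrite gerBl mulr_ge0.
elim: m km => [|m IH]; first by rewrite leqn0 => /eqP->; rewrite !subrr normr0.
rewrite leq_eqVlt => /predU1P[->|]; first by rewrite !subrr normr0.
rewrite ltnS => /IH km; rewrite -(subrKA (A m)).
apply: le_trans (ler_normD _ _) _.
have := x_step m; rewrite -/(A m) -/(A m.+1) -/(h m) => xm.
have : h m.+1 = 2^-1 * h m by rewrite /h exprS.
lra.
Qed.

Let A_bound k : `|A k| <= `|A 0| + 4.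
Proof.
rewrite -[A k](subrK (A 0)) addrC (le_trans (ler_normD _ _))// lerD2l.
by have := A_dist (leq0n k); rewrite /h expr0 mulr1.
Qed.

Let A_apply_dist k m z : (k <= m)%N -> `|A m z - A k z| <= 4 * h k * `|z|.
Proof.
move=> km; rewrite -hsB (le_trans (hs_apply_le uP _ _))//.
by rewrite ler_wpM2r// A_dist.
Qed.

Let A_cvg z : cvgn (fun n => A n z).
Proof.
apply/cauchy_cvgP/cauchy_exP => e e0.
have z1 : 0 < 4 * (`|z| + 1) by rewrite mulr_gt0// ltr_wpDl.
have [k ke] := half_expr_lt (divr_gt0 e0 z1).
exists (A k z); exists k => // m /= km; rewrite -ball_normE /ball_ /= distrC.
apply: le_lt_trans (A_apply_dist _ km) _.
move: ke; rewrite ltr_pdivlMr// -/(h k) => ke.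
have := h_ge0 k; have := normr_ge0 z.
nra.
Qed.

(** The limit is taken pointwise; its Hilbert-Schmidt property and the rate of convergence come from
    finite partial sums, as in Fatou's lemma. *)
Let L z : H := limn (fun n => A n z).

Let AL z : (fun n => A n z) @ \oo --> L z. Proof. exact: A_cvg. Qed.

Let L_linear : linear L.
Proof.
move=> a y z; apply: cvg_lim => //.
have -> : (fun n => A n (a *: y + z)) = (fun n => a *: A n y + A n z).
  by apply/funext => n; have [-> _ _ _] := hsP (A n).
by apply: cvgD; [exact: cvgZl_tmp|exact: AL].
Qed.

Let L_bound z : `|L z| <= (`|A 0| + 4) * `|z|.
Proof.
apply: (@cvg_le_cst _ (fun n => `|A n z|)); first exact: cvg_norm.
apply: nearW => n; apply: le_trans (hs_apply_le uP _ _) _.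
by rewrite ler_wpM2r.
Qed.

Let L_continuous : continuous L.
Proof.
move=> y; apply/cvgrPdist_lt => e e0.
have C0 : 0 < `|A 0| + 4 by rewrite ltr_wpDl.
have := nbhsx_ballx y _ (divr_gt0 e0 C0); apply: filterS => z.
rewrite -ball_normE /ball_ /= ltr_pdivlMr// mulrC => yz.
have -> : L y - L z = L (y - z).
  have := L_linear (-1) z y; rewrite !scaleN1r (addrC (- z)) => ->.
  by rewrite addrC.
exact: le_lt_trans (L_bound _) yz.
Qed.

Let cvg_inner_A y z : (fun n => inner (A n y) z) @ \oo --> (inner (L y) z : R^o).
Proof. exact: cvg_innerl. Qed.

Let L_self_adjoint : self_adjoint L.
Proof.
move=> y z; rewrite -(cvg_lim _ (cvg_inner_A (y := y) (z := z)))//.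
rewrite [RHS]innerC -(cvg_lim _ (cvg_inner_A (y := z) (z := y)))//.
congr (limn _); apply/funext => n.
by have [_ _ -> _] := hsP (A n); rewrite innerC.
Qed.

Let cvg_sum_sqr (f : nat -> nat -> H) (g : nat -> H) n :
  (forall k, (fun m => f m k) @ \oo --> g k) ->
  (fun m => \sum_(0 <= k < n) `|f m k| ^+ 2) @ \oo -->
    (\sum_(0 <= k < n) `|g k| ^+ 2 : R^o).
Proof.
move=> fg; elim: n => [|n IH].
  by rewrite big_geq//; under eq_fun do rewrite big_geq//; exact: cvg_cst.
rewrite big_nat_recr//=; under eq_fun do rewrite big_nat_recr//=.
apply: cvgD => //; rewrite expr2; under eq_fun do rewrite expr2.
by apply: cvgM; apply: cvg_norm; exact: fg.
Qed.

Let L0 : L 0 = 0.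
Proof.
by have := L_linear (-1) 0 0; rewrite scaler0 addr0 scaleN1r addNr.
Qed.

Let L_hilbert_schmidt : hilbert_schmidt L.
Proof.
rewrite /hilbert_schmidt /summable.
have -> : (\esum_(e in @onb R H) `|(`|L e| ^+ 2)%:E| =
    \esum_(e in @onb R H) (`|L e| ^+ 2)%:E)%E.
  by apply: eq_esum => e _; rewrite gee0_abs// lee_fin sqr_ge0.
rewrite (hilbert_schmidtE uP L0).
apply: (@le_lt_trans _ _ ((`|A 0| + 4) ^+ 2)%:E); last exact: ltry.
apply: nneseries_le_cst => [k|n]; first exact: sqr_ge0.
have ALu k : (fun m => A m (u k)) @ \oo --> L (u k) by exact: AL.
have := @cvg_sum_sqr (fun m k => A m (u k)) (fun k => L (u k)) n ALu.
move/cvg_le_cst; apply.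
apply: nearW => m; apply: le_trans (hs_sum_le uP _ _) _.
by rewrite lerXn2r ?nnegrE ?addr_ge0.
Qed.

Let Lhs : hs H := HS (mem_set (And4 L_linear L_continuous L_self_adjoint
  L_hilbert_schmidt) : L \in @sa_hs R H).

Let L_positive : positive_hs Lhs.
Proof.
move=> y; rewrite -oppr_le0.
apply: (@cvg_le_cst _ (fun n => - inner (A n y) y)).
  by apply: cvgN; exact: cvg_inner_A.
apply: nearW => n; rewrite oppr_le0.
by have /set_mem := valP (x n : hs_cone_top H); apply.
Qed.

(** Each partial sum for [A k - Lhs] is the limit in [m] of those for [A k - A m], which [A_dist]
    bounds uniformly in [m >= k]. *)
Lemma hs_cone_complete : exists l : X,
  forall k, `|op (x k) - op l| <= 4 * 2^-1 ^+ k.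
Proof.
exists (exist _ Lhs (mem_set L_positive)) => k.
rewrite -[`|_|]/(`|A k - Lhs|) -/(h k).
rewrite -(@ler_pXn2r _ 2)// ?nnegrE ?mulr_ge0//.
apply: (hs_norm_le uP) => n.
have := @cvg_sum_sqr (fun m i => (A k - A m : hs H) (u i))
  (fun i => (A k - Lhs : hs H) (u i)) n.
move/(_ (fun i => cvgB (cvg_cst _) (AL (z := u i)))) => /cvg_le_cst; apply.
exists k => // m /= km; apply: (le_trans (hs_sum_le uP (A k - A m) n)).
by rewrite lerXn2r ?nnegrE ?mulr_ge0// distrC A_dist.
Qed.

End cone_completeness.

Section cone_coding.
Context (R : realType) (H : hilbertType R).
Local Notation X := (hs_cone H).

Lemma measurable_hs_coneE : @measurable _ X =
  <<s [set @op R H @^-1` U | U in [set U : set (hs H) | open U]] >>.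
Proof. by []. Qed.

Lemma op_inj : injective (@op R H).
Proof. exact: val_inj. Qed.

End cone_coding.

Theorem corollary3p3 (R : realType) (H : hilbertType R) (Hsep : separable H)
    (b : hs H) (B : hs H -> hs H) (m : {measure set (hs_cone H) -> \bar R})
    (mu : set (hs_cone H) -> hs_cone H)
    (Hadm : admissible b B m mu)
    (Hspec : (spectral_bound (effective_drift B mu) < 0)%E)
    (p : R -> R.-pker (hs_cone H) ~> (hs_cone H))
    (Hp : affine_kernels b B m mu p)
    (pi : probability (hs_cone H) R) (Hpi : invariant_measure p pi) :
  exists (d : measure_display) (W : measurableType d) (P : probability W R)
         (X : R -> W -> hs_cone H),
    markov_process p P X /\
    forall t, 0 <= t -> forall A, measurable A ->
      pushforward P (X t) A = pi A.
Proof.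
have [u uP] := basis_sequence_ex Hsep.
have [c cP] := hs_cone_dense Hsep uP.
have [bit [dec [mbit mdec bitK]]] := polish_coding (@op_inj R H)
  (measurable_hs_coneE H) (hs_cone_complete uP) cP.
have [psg _] := Hp.
have [Q [Qmarkov Q_law]] := markov_process_exists mbit mdec bitK pi psg.
exists _, (product_space R (hs_cone H)), Q, (fun t w => w t); split => //.
(* Started from [pi], the marginal at time [t] is the integral that invariance evaluates. *)
by move=> t t0 A mA; rewrite -(Hpi _ _ t0 mA); exact: Q_law.
Qed.
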